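(* Let $\mathcal L$ be the thermal Lindbladian of a Hamiltonian $H$ on $n$ qubits at inverse temperature $\beta>0$ (defined in the context). Fix $t>0$ and any initial state $\sigma_0$. Then the time-averaged state $$\overline{\sigma}_t=\frac1t\int_0^te^{s\mathcal L}[\sigma_0]\,ds$$ satisfies $\|\mathcal L[\overline\sigma_t]\|_1\le\frac2t$, i.e. it is $\frac{2}{t}$-metastable.
   Context: $H$ is a Hermitian operator on $n$ qubits and $0<\kappa\le1/\beta$ is a Gaussian width. With $f(t)=e^{-\kappa^2t^2}\sqrt{\kappa\sqrt{2/\pi}}$, for an operator $A$ put $\hat A(\omega)=\frac1{\sqrt{2\pi}}\int_{-\infty}^\infty e^{iHt}Ae^{-iHt}e^{-i\omega t}f(t)\,dt$ and $\hat A(\omega,t)=e^{iHt}\hat A(\omega)e^{-iHt}$. With $\gamma(\omega)=\exp(-\beta\max(\omega+\beta\kappa^2/2,0))$, for a Hermitian jump $A^a$, $$\mathcal L_a[X]=-i[C^a,X]+\int_{-\infty}^\infty\gamma(\omega)\Big(\hat A^a(\omega)X\hat A^a(\omega)^\dagger-\tfrac12\{\hat A^a(\omega)^\dagger\hat A^a(\omega),X\}\Big)d\omega,$$ $C^a=\iint\gamma(\omega)c(t)\,\hat A^a(\omega,t)^\dagger\hat A^a(\omega,t)\,dt\,d\omega$, $c(t)=\frac1{\beta\sinh(2\pi t/\beta)}$ (principal value at $t=0$; $C^a$ is Hermitian). The thermal Lindbladian is $\mathcal L[X]=-i[H,X]+\sum_a\mathcal L_a[X]$, summed over all single-qubit Pauli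 jumps. A state $\sigma$ is $\epsilon$-metastable if $\|\mathcal L[\sigma]\|_1\le\epsilon$, with $\|\cdot\|_1$ the trace norm. *)

(* Defs.v *)
From HB Require Import structures.
From mathcomp Require Import all_boot all_order all_algebra.
From mathcomp Require Import spectral complex mxtens.
From mathcomp Require Import all_classical all_reals all_analysis.

Set Implicit Arguments.
Unset Strict Implicit.
Unset Printing Implicit Defensive.

Import Order.TTheory GRing.Theory Num.Theory.
Import numFieldNormedType.Exports.

Local Open Scope classical_set_scope.
Local Open Scope ring_scope.
Local Open Scope complex_scope.
Local Open Scope sesquilinear_scope.

Section Calculus.
Variable R : realType.
Local Notation C := R[i].
Local Notation mu := (@lebesgue_measure R).

(* Applies a real functional (an integral, a limit) to the real and imaginary
   parts of every entry of a family of complex matrices. *)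
Definition mx_lift (T : Type) (Lam : (T -> R) -> R) m (F : T -> 'M[C]_m) :
    'M[C]_m :=
  \matrix_(i, j) (Lam (fun x => complex.Re (F x i j))
                  +i* Lam (fun x => complex.Im (F x i j))).

Definition mx_lim m (u : nat -> 'M[C]_m) : 'M[C]_m :=
  mx_lift (fun v : R^nat => limn v) u.

Definition mx_integral (D : set R) m (F : R -> 'M[C]_m) : 'M[C]_m :=
  mx_lift (fun g : R -> R => Rintegral mu D g) F.

(* principal value at 0, over the whole line *)
Definition pv_integral (g : R -> R) : R :=
  lim (Rintegral mu [set t : R | e <= `|t|] g @[e --> 0^'+]).

Definition mx_pv_integral m (F : R -> 'M[C]_m) : 'M[C]_m :=
  mx_lift pv_integral F.

Definition mx_exp m (A : 'M[C]_m) : 'M[C]_m :=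
  mx_lim (fun N => \sum_(0 <= k < N) ((k`!%:R : R)^-1)%:C *: A ^+ k).

(* exp(s T)[X] for a superoperator T *)
Definition superop_exp m (T : 'M[C]_m -> 'M[C]_m) (s : R) (X : 'M[C]_m) :
    'M[C]_m :=
  mx_lim (fun N => \sum_(0 <= k < N) (s ^+ k / k`!%:R)%:C *: iter k T X).

Definition cexpi (x : R) : C := cos x +i* sin x.

Definition sinh (x : R) : R := (expR x - expR (- x)) / 2.

End Calculus.

Section QuantumStates.
Variables (R : realType) (m : nat).
Local Notation C := R[i].

Definition commutator (A B : 'M[C]_m) : 'M[C]_m := A *m B - B *m A.

Definition anticommutator (A B : 'M[C]_m) : 'M[C]_m := A *m B + B *m A.

(* Tr sqrt(X^dagger X), i.e. the sum of the singular values; the eigenvalues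
   of X^dagger X are real and nonnegative, so taking Re loses nothing. *)
Definition trace_norm (X : 'M[C]_m) : R :=
  \sum_(i < m) Num.sqrt (complex.Re (spectral_diag (X^t* *m X) 0 i)).

(* 0 <= z in C includes that z is real *)
Definition psdmx (A : 'M[C]_m) : Prop :=
  forall v : 'cV[C]_m, 0 <= (v^t* *m A *m v) 0 0.

Definition is_state (sigma : 'M[C]_m) : Prop :=
  [/\ sigma \is hermsymmx, psdmx sigma & \tr sigma = 1].

End QuantumStates.

Section Pauli.
Variable R : realType.
Local Notation C := R[i].

Definition mx22 (a b c d : C) : 'M[C]_2 :=
  \matrix_(i < 2, j < 2)
    if i == 0 then (if j == 0 then a else b) else (if j == 0 then c else d).

Definition pauli (p : 'I_3) : 'M[C]_2 :=
  match val p with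
  | 0%N => mx22 0 1 1 0
  | 1%N => mx22 0 (- 'i) 'i 0
  | _ => mx22 1 0 0 (- 1)
  end.

Lemma qubit_dim n (j : 'I_n) : (2 ^ j * 2 * 2 ^ (n - j.+1) = 2 ^ n)%N.
Proof. by rewrite -expnSr -expnD subnKC. Qed.

(* I^{(x) j} (x) P (x) I^{(x) (n-1-j)} *)
Definition qubit_pauli n (j : 'I_n) (p : 'I_3) : 'M[C]_(2 ^ n) :=
  castmx (qubit_dim j, qubit_dim j)
    (tensmx (tensmx (1%:M : 'M[C]_(2 ^ j)) (pauli p))
            (1%:M : 'M[C]_(2 ^ (n - j.+1)))).

End Pauli.

Section ThermalLindbladian.
Variables (R : realType) (beta kappa : R).
Local Notation C := R[i].

Definition gauss_filter (t : R) : R :=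
  expR (- (kappa ^+ 2 * t ^+ 2)) * Num.sqrt (kappa * Num.sqrt (2 / pi)).

Definition transition_weight (w : R) : R :=
  expR (- beta * Num.max (w + beta * kappa ^+ 2 / 2) 0).

Definition coherent_kernel (t : R) : R :=
  (beta * sinh (2 * pi * t / beta))^-1.

Section Operators.
Variables (m : nat) (H : 'M[C]_m).

Definition heisenberg (t : R) (A : 'M[C]_m) : 'M[C]_m :=
  mx_exp ((t *i) *: H) *m A *m mx_exp ((- t *i) *: H).

Definition op_fourier (A : 'M[C]_m) (w : R) : 'M[C]_m :=
  ((Num.sqrt (2 * pi))^-1)%:C *:
  mx_integral setT
    (fun t => (cexpi (- (w * t)) * (gauss_filter t)%:C) *: heisenberg t A).

Definition op_fourier_at (A : 'M[C]_m) (w t : R) : 'M[C]_m :=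
  heisenberg t (op_fourier A w).

(* The kernel has a nonintegrable singularity at t = 0: the t-integral is a
   principal value, taken before the (absolutely convergent) w-integral. *)
Definition coherent_term (A : 'M[C]_m) : 'M[C]_m :=
  mx_integral setT (fun w => (transition_weight w)%:C *:
    mx_pv_integral (fun t => (coherent_kernel t)%:C *:
      ((op_fourier_at A w t)^t* *m op_fourier_at A w t))).

Definition jump_lindbladian (A X : 'M[C]_m) : 'M[C]_m :=
  - 'i *: commutator (coherent_term A) X
  + mx_integral setT (fun w => (transition_weight w)%:C *:
      (op_fourier A w *m X *m (op_fourier A w)^t*
       - 2^-1 *: anticommutator ((op_fourier A w)^t* *m op_fourier A w) X)).

End Operators.

Variables (n : nat) (H : 'M[C]_(2 ^ n)).

Definition thermal_lindbladian (X : 'M[C]_(2 ^ n)) : 'M[C]_(2 ^ n) :=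
  - 'i *: commutator H X
  + \sum_(j < n) \sum_(p < 3) jump_lindbladian H (qubit_pauli R j p) X.

Definition metastable (eps : R) (sigma : 'M[C]_(2 ^ n)) : Prop :=
  is_state sigma /\ trace_norm (thermal_lindbladian sigma) <= eps.

Definition time_average (t : R) (sigma0 : 'M[C]_(2 ^ n)) : 'M[C]_(2 ^ n) :=
  (t^-1)%:C *:
  mx_integral `[0, t] (fun s => superop_exp thermal_lindbladian s sigma0).

End ThermalLindbladian.

(* Main.v *)
Require Import Defs.
From HB Require Import structures.
From mathcomp Require Import all_boot all_order all_algebra.
From mathcomp Require Import spectral complex.
From mathcomp Require Import all_classical all_reals all_analysis.
From mathcomp Require Import measurable_realfun lebesgue_integral_under.
From mathcomp Require Import ring lra.

(* Writing [u s = exp (s L) sigma_0], the fundamental theorem of calculus gives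
   [L (1/t int_0^t u) = (u t - sigma_0) / t], and a difference of two states has
   trace norm at most 2.  So everything rests on [exp (s L)] preserving states.
   Trace and hermiticity are immediate termwise; for positivity, [L] has the form
   [L X = Phi X + G X + X G'] with [Phi] positive and [G'] the adjoint of [G],
   hence [exp (s L)] is the limit of the positive maps
   [(X |-> e Phi X + (1 + e G) X (1 + e G)')^N], [e = s / N].
   That the thermal Lindbladian has this form requires the [w]-integral of the
   dissipator to converge: the weight [gamma] is only bounded, and the decay
   comes from [A^(w)], which by the spectral theorem is a finite combination of
   translates of the Fourier transform of a Gaussian.  The principal value in
   the coherent term plays no role beyond being an odd functional (its junk value
   included), which makes [C^a] Hermitian. *)

Set Implicit Arguments.
Unset Strict Implicit.
Unset Printing Implicit Defensive.

Import Order.TTheory GRing.Theory Num.Theory.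
Import numFieldNormedType.Exports.

Local Open Scope classical_set_scope.
Local Open Scope ring_scope.
Local Open Scope complex_scope.
Local Open Scope sesquilinear_scope.

(** * Linear functionals applied entrywise *)

(** Integrals and limits of matrices are total operations on the real and imaginary parts of the
    entries, with default values on divergence, so convergence must be carried along. [linrel] does
    this once for limits, integrals, integrability and decay: in finite dimension a linear map is a
    finite combination of entries and passes through any such relation, which covers the trace,
    quadratic forms and the generator without a topology on matrices. The Euler step [X + e L X]
    need not be positive; completing the square costs a term of second order in [e], which perturbs
    each fixed power of [L] by [O(e)] only, and an exponential majorant controls all powers
    together. No closed form of the Gaussian transform is used: the dissipator contains two factors
    of [A^(w)], so decay of order [1/(1+|w|)] is enough, and one integration by parts supplies it.
    The trace norm is defined by the eigenvalues of [X'X], while the estimate lives in an eigenbasis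
    of [X]; a doubly stochastic matrix links the two without matching multiplicities. *)

Section LinearRelation.
Variables (R : realType) (T : Type).
Local Notation C := R[i].
Implicit Types (I : (T -> R) -> R -> Prop) (f g : T -> C) (z w : C).

(* [I u a] reads: the functional is defined at [u], with value [a] (for instance
   [u] is integrable with integral [a], or [u] converges to [a]). *)
Definition linrel I :=
  [/\ I (fun=> 0) 0,
      forall u v a b, I u a -> I v b -> I (fun x => u x + v x) (a + b)
    & forall u a c, I u a -> I (fun x => c * u x) (c * a)].

Definition crel I f z :=
  I (fun x => complex.Re (f x)) (complex.Re z) /\
  I (fun x => complex.Im (f x)) (complex.Im z).

Definition mxrel I m p (F : T -> 'M[C]_(m, p)) (Z : 'M[C]_(m, p)) :=
  forall i j, crel I (fun x => F x i j) (Z i j).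

Variable I : (T -> R) -> R -> Prop.
Hypothesis linI : linrel I.

Lemma crel0 : crel I (fun=> 0) 0.
Proof. by case: linI. Qed.

Lemma crelD f g z w : crel I f z -> crel I g w ->
  crel I (fun x => f x + g x) (z + w).
Proof.
case: linI => _ HD _ [fr fi] [gr gi]; split.
  have := HD _ _ _ _ fr gr; rewrite -raddfD /=.
  by under eq_fun do rewrite -raddfD.
have := HD _ _ _ _ fi gi; rewrite -raddfD /=.
by under eq_fun do rewrite -raddfD.
Qed.

Lemma Re_mul z w : complex.Re (z * w) =
  complex.Re z * complex.Re w - complex.Im z * complex.Im w.
Proof. by case: z; case: w. Qed.

Lemma Im_mul z w : complex.Im (z * w) =
  complex.Re z * complex.Im w + complex.Im z * complex.Re w.
Proof. by case: z => a b; case: w. Qed.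

Lemma crelZ a f z : crel I f z -> crel I (fun x => a * f x) (a * z).
Proof.
case: linI => _ HD HZ [fr fi]; split.
  have := HD _ _ _ _ (HZ _ _ (complex.Re a) fr) (HZ _ _ (- complex.Im a) fi).
  rewrite mulNr -Re_mul.
  by under eq_fun do rewrite mulNr -Re_mul.
have := HD _ _ _ _ (HZ _ _ (complex.Re a) fi) (HZ _ _ (complex.Im a) fr).
rewrite -Im_mul.
by under eq_fun do rewrite -Im_mul.
Qed.

Lemma crelZr a f z : crel I f z -> crel I (fun x => f x * a) (z * a).
Proof.
by move=> /(crelZ a); rewrite mulrC; under eq_fun do rewrite mulrC.
Qed.

Lemma crel_sum (J : Type) (s : seq J) (Q : pred J) (F : J -> T -> C) (z : J -> C) :
  (forall i, crel I (F i) (z i)) ->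
  crel I (fun x => \sum_(i <- s | Q i) F i x) (\sum_(i <- s | Q i) z i).
Proof.
move=> H; elim: s => [|i s IH].
  by rewrite big_nil; under eq_fun do rewrite big_nil; exact: crel0.
rewrite big_cons; under eq_fun do rewrite big_cons.
by case: (Q i) => //; apply: crelD.
Qed.

Lemma crel_sum0 (J : Type) (s : seq J) (Q : pred J) (F : J -> T -> C) :
  (forall i, crel I (F i) 0) -> crel I (fun x => \sum_(i <- s | Q i) F i x) 0.
Proof. by move=> H; have := @crel_sum J s Q F (fun=> 0) H; rewrite big1_eq. Qed.

Lemma crel_conj f z : crel I f z -> crel I (fun x => (f x)^*) z^*.
Proof.
case: linI => _ _ HZ [fr fi]; split.
  have E (y : C) : complex.Re y^* = complex.Re y by case: y.
  by rewrite E; under eq_fun do rewrite E.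
have E (y : C) : complex.Im y^* = - 1 * complex.Im y by case: y => a b /=; rewrite mulN1r.
by rewrite E; under eq_fun do rewrite E; apply: HZ.
Qed.

(** Expanding in matrix units makes [phi] a finite combination of entries, so linearity of the
    relation is all that is used. Traces and quadratic forms are moved through integrals and limits
    this way. *)
Lemma mxrel_scalar m p (phi : 'M[C]_(m, p) -> C) F Z :
  scalar phi -> mxrel I F Z -> crel I (fun x => phi (F x)) (phi Z).
Proof.
move=> lphi H.
pose phiL : {scalar 'M[C]_(m, p)} := HB.pack phi (GRing.isLinear.Build _ _ _ _ phi lphi).
have E (X : 'M[C]_(m, p)) : phi X = \sum_i \sum_j X i j * phi (delta_mx i j).
  rewrite {1}[X]matrix_sum_delta -[phi]/(phiL : _ -> _) linear_sum.
  apply: eq_bigr => i _; rewrite linear_sum; apply: eq_bigr => j _.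
  by rewrite linearZ.
rewrite E; under eq_fun do rewrite E.
by do 2!apply: crel_sum => ?; apply: crelZr.
Qed.

Lemma mxrel_linear m p m' p' (l : 'M[C]_(m, p) -> 'M[C]_(m', p')) F Z :
  linear l -> mxrel I F Z -> mxrel I (fun x => l (F x)) (l Z).
Proof.
move=> ll H i j; apply: (@mxrel_scalar _ _ (fun X => l X i j)) => // a X Y.
by rewrite ll !mxE.
Qed.

Lemma mxrelD m p F G (Z W : 'M[C]_(m, p)) :
  mxrel I F Z -> mxrel I G W -> mxrel I (fun x => F x + G x) (Z + W).
Proof.
move=> FZ GW i j; rewrite mxE; under eq_fun do rewrite mxE.
exact: crelD (FZ i j) (GW i j).
Qed.

Lemma mxrelZ m p a F (Z : 'M[C]_(m, p)) :
  mxrel I F Z -> mxrel I (fun x => a *: F x) (a *: Z).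
Proof.
by apply: mxrel_linear => b X Y; rewrite scalerDr !scalerA mulrC.
Qed.

(** Bridge from the relation back to the total functional: a witnessed value rules out the default
    one. *)
Lemma mx_lift_mxrel (Lam : (T -> R) -> R) m F (Z : 'M[C]_m) :
  (forall u a, I u a -> Lam u = a) -> mxrel I F Z -> mx_lift Lam F = Z.
Proof.
move=> LI FZ; apply/matrixP => i j; rewrite mxE.
by case: (FZ i j) => /LI -> /LI ->; case: (Z i j).
Qed.

End LinearRelation.

(** * Hermitian matrices and odd functionals *)

Section Hermitian.
Variable R : realType.
Local Notation C := R[i].

Lemma trmxC_E m p (A : 'M[C]_(m, p)) i j : (A^t*) i j = (A j i)^*.
Proof. by rewrite !mxE. Qed.

Lemma conjc_realM (a : R) (z : C) : (a%:C * z)^* = a%:C * z^*.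
Proof.
by case: z => x y; apply/eqP; rewrite eq_complex /= !mul0r !subr0 !addr0 mulrN !eqxx.
Qed.

Lemma hermP m (A : 'M[C]_m) : A \is hermsymmx <-> A^t* = A.
Proof.
split=> [/is_hermitianmxP|E]; last apply/is_hermitianmxP.
  by rewrite expr0 scale1r => {2}->.
by rewrite expr0 scale1r E.
Qed.

(** In a Hermitian family the real parts are symmetric and the imaginary parts antisymmetric, so
    oddness of [Lam] suffices. *)
Lemma mx_lift_herm (T : Type) (Lam : (T -> R) -> R) m (F : T -> 'M[C]_m) :
  (forall f, Lam (fun x => - f x) = - Lam f) ->
  (forall x, (F x)^t* = F x) -> (mx_lift Lam F)^t* = mx_lift Lam F.
Proof.
move=> LN FE; apply/matrixP => i j; rewrite trmxC_E !mxE.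
have E x : F x j i = (F x i j)^* by rewrite -[in LHS]FE trmxC_E.
have -> : (fun x => complex.Re (F x j i)) = fun x => complex.Re (F x i j).
  by apply/funext => x; rewrite E; case: (F x i j).
have -> : (fun x => complex.Im (F x j i)) = fun x => - complex.Im (F x i j).
  by apply/funext => x; rewrite E; case: (F x i j).
by rewrite LN /= opprK.
Qed.

(** Negation swaps the integrals of the positive and negative parts, and [fine] sends every infinite
    difference to 0, so the identity also covers nonintegrable functions. *)
Lemma Rintegral_opp d (T : measurableType d) (mu : {measure set T -> \bar R})
  (D : set T) (f : T -> R) :
  Rintegral mu D (fun x => - f x) = - Rintegral mu D f.
Proof.
rewrite /Rintegral.
rewrite integralE [X in _ = - fine X]integralE.
have -> : (\int[mu]_(x in D) ((fun x => (- f x)%:E)^\+ x) = \int[mu]_(x in D) ((fun x => (f x)%:E)^\- x))%E.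
  by rewrite -funeposN.
have -> : (\int[mu]_(x in D) ((fun x => (- f x)%:E)^\- x) = \int[mu]_(x in D) ((fun x => (f x)%:E)^\+ x))%E.
  by rewrite -funenegN.
set a := integral _ _ _; set b := integral _ _ _.
by case: a => [a| |]; case: b => [b| |] //=; rewrite ?oppr0 ?opprB.
Qed.

Lemma lim_opp (T : Type) (F : set_system T) {FF : ProperFilter F} (f : T -> R) :
  lim ((- f x) @[x --> F]) = - lim (f x @[x --> F]).
Proof.
have [cf|ncf] := pselect (cvg (f x @[x --> F])).
  by apply/cvg_lim => //; exact: cvgN.
have nc : ~ cvg ((- f x) @[x --> F]).
  by move=> /is_cvgN; rewrite (_ : - _ = f) //; apply/funext => x; rewrite /= opprK.
(* A divergent limit takes the default value [point], which is 0 in [R] and hence its own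
   opposite. *)
by rewrite (dvgP nc) (dvgP ncf) oppr0.
Qed.

Lemma pv_integral_opp (g : R -> R) :
  pv_integral (fun x => - g x) = - pv_integral g.
Proof.
by rewrite /pv_integral; under eq_fun do rewrite Rintegral_opp; rewrite lim_opp.
Qed.

End Hermitian.

(** * Exponential series *)

Section EntrywiseNorm.
Variable R : realType.
Local Notation C := R[i].

(** Takes values in [R], unlike the norm of [R[i]], and dominates both the real and the imaginary
    part. *)
Definition cnorm1 (z : C) : R := `|complex.Re z| + `|complex.Im z|.

Lemma cnorm1_ge0 z : 0 <= cnorm1 z.
Proof. by rewrite addr_ge0. Qed.

Lemma cnorm1D z w : cnorm1 (z + w) <= cnorm1 z + cnorm1 w.
Proof.
rewrite /cnorm1 !raddfD /= addrACA.
by apply: lerD; apply: ler_normD.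
Qed.

Lemma cnorm1M z w : cnorm1 (z * w) <= cnorm1 z * cnorm1 w.
Proof.
rewrite /cnorm1 Re_mul Im_mul mulrDl !mulrDr -!normrM.
have := ler_normB (complex.Re z * complex.Re w) (complex.Im z * complex.Im w).
have := ler_normD (complex.Re z * complex.Im w) (complex.Im z * complex.Re w).
by lra.
Qed.

Lemma cnorm1_sum (J : Type) (s : seq J) (F : J -> C) :
  cnorm1 (\sum_(i <- s) F i) <= \sum_(i <- s) cnorm1 (F i).
Proof.
elim: s => [|i s IH]; first by rewrite !big_nil /cnorm1 /= normr0 addr0.
by rewrite !big_cons (le_trans (cnorm1D _ _))// lerD2l.
Qed.

Definition mxnorm1 m p (X : 'M[C]_(m, p)) : R := \sum_i \sum_j cnorm1 (X i j).

Lemma mxnorm1_ge0 m p (X : 'M[C]_(m, p)) : 0 <= mxnorm1 X.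
Proof. by do 2!(apply: sumr_ge0 => ? _); exact: cnorm1_ge0. Qed.

Lemma mxnorm1_entry m p (X : 'M[C]_(m, p)) i j : cnorm1 (X i j) <= mxnorm1 X.
Proof.
rewrite /mxnorm1 (bigD1 i)//= (bigD1 j)//= -addrA lerDl addr_ge0//.
  by apply: sumr_ge0 => ? _; exact: cnorm1_ge0.
by do 2!(apply: sumr_ge0 => ? _); exact: cnorm1_ge0.
Qed.

Lemma mxnorm1D m p (X Y : 'M[C]_(m, p)) : mxnorm1 (X + Y) <= mxnorm1 X + mxnorm1 Y.
Proof.
rewrite /mxnorm1 -big_split; apply: ler_sum => i _.
rewrite -big_split; apply: ler_sum => j _.
by rewrite mxE cnorm1D.
Qed.

Lemma mxnorm1Z m p a (X : 'M[C]_(m, p)) : mxnorm1 (a *: X) <= cnorm1 a * mxnorm1 X.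
Proof.
rewrite /mxnorm1 mulr_sumr; apply: ler_sum => i _.
rewrite mulr_sumr; apply: ler_sum => j _.
by rewrite mxE cnorm1M.
Qed.

Lemma scalar_bounded m p (phi : 'M[C]_(m, p) -> C) : scalar phi ->
  exists2 K : R, 0 <= K & forall X, cnorm1 (phi X) <= K * mxnorm1 X.
Proof.
move=> lphi.
pose phiL : {scalar 'M[C]_(m, p)} := HB.pack phi (GRing.isLinear.Build _ _ _ _ phi lphi).
exists (\sum_i \sum_j cnorm1 (phi (delta_mx i j))).
  by do 2!(apply: sumr_ge0 => ? _); exact: cnorm1_ge0.
move=> X; rewrite {1}[X]matrix_sum_delta -[phi]/(phiL : _ -> _) linear_sum.
rewrite (le_trans (cnorm1_sum _ _))// mulr_suml; apply: ler_sum => i _.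
rewrite linear_sum (le_trans (cnorm1_sum _ _))// mulr_suml; apply: ler_sum => j _.
rewrite linearZ /= mulrC (le_trans (cnorm1M _ _))//.
by rewrite ler_wpM2l ?cnorm1_ge0// mxnorm1_entry.
Qed.

Lemma linear_bounded m p m' p' (l : 'M[C]_(m, p) -> 'M[C]_(m', p')) : linear l ->
  exists2 K : R, 0 <= K & forall X, mxnorm1 (l X) <= K * mxnorm1 X.
Proof.
move=> ll.
have /choice[K HK] (ij : 'I_m' * 'I_p') :
    exists K : R, 0 <= K /\ forall X, cnorm1 (l X ij.1 ij.2) <= K * mxnorm1 X.
  have [|K K0 HK] := @scalar_bounded _ _ (fun X => l X ij.1 ij.2).
    by move=> a X Y; rewrite ll !mxE.
  by exists K.
exists (\sum_i \sum_j K (i, j)).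
  apply: sumr_ge0 => i _; apply: sumr_ge0 => j _; exact: (HK (i, j)).1.
move=> X; rewrite mulr_suml; apply: ler_sum => i _.
rewrite mulr_suml; apply: ler_sum => j _.
by case: (HK (i, j)).
Qed.

Lemma iter_bounded m (T : 'M[C]_m -> 'M[C]_m) K : 0 <= K ->
  (forall X, mxnorm1 (T X) <= K * mxnorm1 X) ->
  forall X k, mxnorm1 (iter k T X) <= mxnorm1 X * K ^+ k.
Proof.
move=> K0 HK X; elim=> [|k IH]; first by rewrite expr0 mulr1.
rewrite iterS (le_trans (HK _))// exprS mulrCA.
by rewrite ler_wpM2l.
Qed.

End EntrywiseNorm.

(** * Scalar series of exponential type *)

Section ExponentialSeries.
Variable R : realType.
Implicit Types (a : R^nat) (s K M : R).

(** For [a k] the real or imaginary part of [phi (T^k X)], this is the corresponding part of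
    [phi (exp (s T) X)]; the matrix exponential is studied through these scalar series. *)
Definition exp_series a s := limn (series (fun k => s ^+ k / k`!%:R * a k)).

Lemma cvg_exp_series_norm s K M :
  cvgn (series (fun k => `|s| ^+ k / k`!%:R * (M * K ^+ k))).
Proof.
have := @is_cvg_seriesZ _ _ M (is_cvg_series_exp_coeff (`|s| * K)).
rewrite (_ : M *: exp_coeff (`|s| * K) = fun k => `|s| ^+ k / k`!%:R * (M * K ^+ k)) //.
apply/funext => k; rewrite -[LHS]/(M * ((`|s| * K) ^+ k / k`!%:R)) exprMn.
ring.
Qed.

Lemma cvg_exp_series a s K M : 0 <= K -> 0 <= M -> (forall k, `|a k| <= M * K ^+ k) ->
  cvgn (series (fun k => s ^+ k / k`!%:R * a k)).
Proof.
move=> K0 M0 aK; apply: normed_cvg.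
refine (series_le_cvg _ _ _ (@cvg_exp_series_norm s K M)).
- by move=> k; rewrite normr_ge0.
- by move=> k; rewrite !mulr_ge0 ?exprn_ge0 ?invr_ge0.
- move=> k /=; rewrite normrM; apply: ler_pM => //.
  by rewrite normrM normrX normfV [X in _ / X]ger0_norm.
Qed.

(** Termwise differentiation lowers [k!] to [(k-1)!] and so shifts the sequence by one. *)
Lemma is_derive_exp_series a s K M : 0 <= K -> 0 <= M -> (forall k, `|a k| <= M * K ^+ k) ->
  is_derive s (1 : R) (exp_series a) (exp_series (fun k => a k.+1) s).
Proof.
move=> K0 M0 aK.
(* Power series coefficients of the [n]-fold shifted sequence. Formal differentiation takes [sh n]
   to [sh n.+1], so the convergence of both derived series is an instance of [shC]. *)
pose sh n : R^nat := fun k => a (k + n)%N / k`!%:R.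
have shE n x : pseries (sh n) x = series (fun k => x ^+ k / k`!%:R * a (k + n)%N).
  by congr series; apply/funext => k; rewrite /sh /=; ring.
have shD n : pseries_diffs (sh n) = sh n.+1.
  apply/funext => k; rewrite /pseries_diffs /sh addnS addSn factS natrM invfM.
  rewrite mulrCA; congr (_ * _).
  by rewrite mulrA mulfV ?mul1r.
have shC n x : cvgn (pseries (sh n) x).
  rewrite shE; apply: (@cvg_exp_series _ _ K (M * K ^+ n)) => //.
    by rewrite mulr_ge0 ?exprn_ge0.
  by move=> k; rewrite -mulrA -exprD addnC.
have -> : exp_series a = fun x => limn (pseries (sh 0%N) x).
  by apply/funext => x; rewrite shE /exp_series; under [in RHS]eq_fun do rewrite addn0.
have -> : exp_series (fun k => a k.+1) s = limn (pseries (pseries_diffs (sh 0%N)) s).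
  by rewrite shD shE /exp_series; under [in RHS]eq_fun do rewrite addn1.
apply: (@pseries_snd_diffs _ _ (`|s| + 1)); rewrite ?shD //.
by rewrite [ltRHS]ger0_norm ?addr_ge0// ltrDl.
Qed.

(** Since [C(N, k) = N^_k / k!], this ratio is the factor between the terms of [(1 + s/N)^N] and
    those of the exponential series. *)
Lemma cvg_ffact_ratio k :
  (fun N => (N.+1 ^_ k)%:R / N.+1%:R ^+ k : R) @ \oo --> (1 : R).
Proof.
elim: k => [|k IH].
  by apply: cvg_near_cst; apply: nearW => N; rewrite ffactn0 expr0 divr1.
rewrite [X in X @ _](_ : _ = fun N => (N.+1 ^_ k)%:R / N.+1%:R ^+ k *
    ((N.+1 - k)%:R / N.+1%:R)); last first.
  by apply/funext => N; rewrite ffactnSr natrM exprSr invfM; ring.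
rewrite -[X in _ --> X]mulr1; apply: cvgM => //.
have : (fun N => 1 - k%:R * N.+1%:R^-1 : R) @ \oo --> (1 - k%:R * 0 : R).
  apply: cvgB; first exact: cvg_cst.
  by apply: cvgM; [exact: cvg_cst|exact: cvg_harmonic].
rewrite mulr0 subr0; apply: cvg_trans; apply: near_eq_cvg; near=> N.
have kN : (k <= N.+1)%N by rewrite leqW//; near: N; exact: nbhs_infty_ge.
by rewrite natrB// mulrBl divff.
Unshelve. all: by end_near.
Qed.

Lemma ffact_le_exp n k : (n ^_ k <= n ^ k)%N.
Proof.
elim: k => [|k IH]; first by rewrite ffactn0.
by rewrite ffactnSr expnSr leq_mul// leq_subr.
Qed.

(* The summands of the truncated binomial sums are dominated by those of an
   exponential series, so the limit may be taken termwise. *)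
Lemma exp_series_ge0 (a : nat -> R^nat) (a0 : R^nat) s K M :
  0 <= s -> 0 <= K -> 0 <= M ->
  (forall N k, `|a N k| <= M * K ^+ k) ->
  (forall k, (fun N => a N k) @ \oo --> a0 k) ->
  (forall N, 0 <= \sum_(0 <= k < N.+2) 'C(N.+1, k)%:R * (s / N.+1%:R) ^+ k * a N k) ->
  0 <= exp_series a0 s.
Proof.
move=> s0 K0 M0 aK aa0 pos.
pose b N k := 'C(N.+1, k)%:R * (s / N.+1%:R) ^+ k * a N k.
pose g k := s ^+ k / k`!%:R * (M * K ^+ k).
pose b0 k := s ^+ k / k`!%:R * a0 k.
have g0 k : 0 <= g k by rewrite !mulr_ge0 ?exprn_ge0 ?invr_ge0.
have cg : cvgn (series g).
  by have := @cvg_exp_series_norm s K M; rewrite ger0_norm.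
(* This form serves twice: the falling-factorial ratio is at most 1, which gives the domination, and
   tends to 1, which gives the termwise limit. *)
have bE N k : b N k = (N.+1 ^_ k)%:R / N.+1%:R ^+ k * (s ^+ k / k`!%:R * a N k).
  rewrite /b -bin_ffact natrM exprMn exprVn.
  have k0 : (k`!%:R : R) != 0 by rewrite pnatr_eq0 -lt0n fact_gt0.
  have N0 : (N.+1%:R ^+ k : R) != 0 by rewrite expf_neq0.
  by field; rewrite k0 N0.
have bg N k : `|b N k| <= g k.
  rewrite bE normrM -[g k]mul1r; apply: ler_pM => //.
    rewrite ger0_norm ?divr_ge0 ?exprn_ge0// ler_pdivrMr ?exprn_gt0// mul1r.
    by rewrite -natrX ler_nat ffact_le_exp.
  rewrite normrM ger0_norm ?divr_ge0 ?exprn_ge0//.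
  by rewrite ler_wpM2l// divr_ge0 ?exprn_ge0.
have bb0 k : (fun N => b N k) @ \oo --> b0 k.
  under eq_fun do rewrite bE; rewrite -[b0 k]mul1r.
  apply: cvgM; first exact: cvg_ffact_ratio.
  by apply: cvgM; [exact: cvg_cst|exact: aa0].
have ndg : nondecreasing_seq (series g).
  by apply/nondecreasing_seqP => n; rewrite /series /= big_nat_recr//= lerDl.
(* The full sum at [N] is nonnegative, and cutting it at [n] loses at most the tail of [g]. Letting
   [N] go to infinity at fixed [n] gives the bound; [n] goes to infinity only afterwards. *)
have tail n : - (limn (series g) - series g n) <= series b0 n.
  have cb : (fun N => series (b N) n) @ \oo --> series b0 n.
    rewrite /series /=; elim: n => [|n IH].
      rewrite big_geq//; under eq_fun do rewrite big_geq//.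
      exact: cvg_cst.
    rewrite big_nat_recr//=; under eq_fun do rewrite big_nat_recr//=.
    exact: cvgD.
  rewrite -(cvg_lim (@Rhausdorff R) cb).
  apply: limr_ge; first by apply/cvg_ex; exists (series b0 n).
  apply: nearW => N.
  (* Binomial coefficients vanish for [k > N.+1], so the partial sums are constant from [N.+2] on;
     the index [n + N.+2] exceeds both [n] and this threshold. *)
  have sb n' : series (b N) (n' + N.+2)%N = series (b N) N.+2.
    rewrite /series /= (@big_cat_nat _ _ _ N.+2) ?leq_addl//= [X in _ + X]big_nat_cond.
    rewrite [X in _ + X]big1 ?addr0// => k /andP[/andP[Nk _] _].
    by rewrite /b bin_small ?mul0r.
  have pN : 0 <= series (b N) N.+2 := pos N.
  rewrite -(sb n) in pN.
  have : series (b N) (n + N.+2)%N - series (b N) n <= series g (n + N.+2)%N - series g n.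
    rewrite /series /= (@big_cat_nat _ _ _ n 0) ?leq_addr//= addrAC subrr add0r.
    rewrite [X in _ <= X - _](@big_cat_nat _ _ _ n 0) ?leq_addr//= addrAC subrr add0r.
    by apply: ler_sum => k _; rewrite (le_trans (ler_norm _)).
  have := nondecreasing_cvgn_le ndg cg (n + N.+2)%N.
  by move: pN; set x := series (b N) _; set y := series g _; set z := limn _; lra.
have cb0 : cvgn (series b0).
  apply: (@cvg_exp_series _ _ K M) => // k.
  rewrite -(cvg_lim (@Rhausdorff R) (cvg_norm (aa0 k))).
  apply: limr_le; last by apply: nearW => N; exact: aK.
  by apply/cvg_ex; exists `|a0 k|; apply: cvg_norm.
have c0 : (fun n => - (limn (series g) - series g n)) @ \oo --> (0 : R).
  rewrite -oppr0 -(subrr (limn (series g))); apply: cvgN; apply: cvgB => //.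
  exact: cvg_cst.
rewrite /exp_series -/b0 -(cvg_lim (@Rhausdorff R) c0).
apply: ler_lim => //; first by apply/cvg_ex; exists 0.
exact: nearW.
Qed.

End ExponentialSeries.

(** * Exponentials of superoperators *)

Section SuperoperatorExponential.
Variables (R : realType) (m : nat).
Local Notation C := R[i].
Implicit Types (X : 'M[C]_m) (T Phi : 'M[C]_m -> 'M[C]_m) (s : R).

Definition seq_cvg (u : R^nat) (a : R) := u @ \oo --> a.

Lemma linrel_seq_cvg : linrel seq_cvg.
Proof.
split=> [|u v a b ua vb|u a c ua]; first exact: cvg_cst.
  exact: cvgD.
by apply: cvgM => //; exact: cvg_cst.
Qed.

Lemma seq_cvg_lim (u : R^nat) a : seq_cvg u a -> limn u = a.
Proof. exact: cvg_lim. Qed.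

Lemma iter_entry_bounded T X : linear T -> exists2 K : R, 0 <= K &
  forall (phi : 'M[C]_m -> C), scalar phi -> exists2 M : R, 0 <= M &
    forall k, `|complex.Re (phi (iter k T X))| <= M * K ^+ k /\
              `|complex.Im (phi (iter k T X))| <= M * K ^+ k.
Proof.
move=> lT; have [K K0 HK] := linear_bounded lT; exists K => // phi lphi.
have [B B0 HB] := scalar_bounded lphi; exists (B * mxnorm1 X).
  by rewrite mulr_ge0// mxnorm1_ge0.
move=> k; have : cnorm1 (phi (iter k T X)) <= B * mxnorm1 X * K ^+ k.
  rewrite (le_trans (HB _))// -mulrA ler_wpM2l//.
  exact: iter_bounded.
rewrite /cnorm1; have := normr_ge0 (complex.Re (phi (iter k T X))).
by have := normr_ge0 (complex.Im (phi (iter k T X))); split; lra.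
Qed.

Lemma scalar_entry m1 m2 (i : 'I_m1) (j : 'I_m2) : scalar (fun Y : 'M[C]_(m1, m2) => Y i j).
Proof. by move=> a Y Z; rewrite !mxE. Qed.

(** Applied to entries, the scalar convergence shows that [superop_exp] is a true limit; then [phi]
    passes through it, and uniqueness of limits identifies the value. *)
Lemma superop_exp_scalar T X s (phi : 'M[C]_m -> C) : linear T -> scalar phi ->
  phi (superop_exp T s X) =
    exp_series (fun k => complex.Re (phi (iter k T X))) s
    +i* exp_series (fun k => complex.Im (phi (iter k T X))) s.
Proof.
move=> lT.
have Re_sum (f : 'M[C]_m -> C) : scalar f -> forall N,
    complex.Re (f (\sum_(0 <= k < N) (s ^+ k / k`!%:R)%:C *: iter k T X)) =
    series (fun k => s ^+ k / k`!%:R * complex.Re (f (iter k T X))) N /\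
    complex.Im (f (\sum_(0 <= k < N) (s ^+ k / k`!%:R)%:C *: iter k T X)) =
    series (fun k => s ^+ k / k`!%:R * complex.Im (f (iter k T X))) N.
  move=> lf N.
  pose fL : {scalar 'M[C]_m} := HB.pack f (GRing.isLinear.Build _ _ _ _ f lf).
  rewrite -[f]/(fL : _ -> _) linear_sum !raddf_sum /series /=.
  by split; apply: eq_bigr => k _; rewrite -[f]/(fL : _ -> _) linearZ /= ?Re_mul ?Im_mul /= mul0r ?subr0 ?addr0.
have cv (f : 'M[C]_m -> C) : scalar f ->
    crel seq_cvg (fun N => f (\sum_(0 <= k < N) (s ^+ k / k`!%:R)%:C *: iter k T X))
    (exp_series (fun k => complex.Re (f (iter k T X))) s
    +i* exp_series (fun k => complex.Im (f (iter k T X))) s).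
  move=> lf; have [K K0 /(_ _ lf)[M M0 HM]] := iter_entry_bounded X lT.
  split => /=.
    under eq_fun do rewrite (Re_sum _ lf _).1.
    by apply: (@cvg_exp_series _ _ _ K M) => // k; case: (HM k).
  under eq_fun do rewrite (Re_sum _ lf _).2.
  by apply: (@cvg_exp_series _ _ _ K M) => // k; case: (HM k).
move=> lphi.
have mcv : mxrel seq_cvg (fun N => \sum_(0 <= k < N) (s ^+ k / k`!%:R)%:C *: iter k T X)
    (superop_exp T s X).
  move=> i j; rewrite mxE.
  have [d1 d2] := cv _ (scalar_entry i j).
  have c1 := seq_cvg_lim d1; have c2 := seq_cvg_lim d2.
  by split; rewrite /= ?c1 ?c2.
have [c1 c2] := mxrel_scalar linrel_seq_cvg lphi mcv.
have [d1 d2] := cv _ lphi.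
apply/eqP; rewrite eq_complex /=; apply/andP; split; apply/eqP.
  exact: cvg_unique c1 d1.
exact: cvg_unique c2 d2.
Qed.

Lemma superop_exp0 T X : linear T -> superop_exp T 0 X = X.
Proof.
move=> lT; apply/matrixP => i j.
rewrite (@superop_exp_scalar T X 0 (fun Y => Y i j) lT (scalar_entry i j)).
have E (a : R^nat) : exp_series a 0 = a 0%N.
  apply: lim_near_cst => //; near=> N.
  have -> : N = N.-1.+1 by rewrite prednK//; near: N; exact: nbhs_infty_gt.
  rewrite /series /= big_nat_recl//= expr0 fact0 divr1 mul1r big1 ?addr0// => k _.
  by rewrite exprS !mul0r.
by rewrite !E /=; case: (X i j).
Unshelve. all: by end_near.
Qed.

Lemma superop_exp_trace T X s : linear T -> (forall Y, \tr (T Y) = 0) ->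
  \tr (superop_exp T s X) = \tr X.
Proof.
move=> lT trT.
have ltr : scalar (fun Y : 'M[C]_m => \tr Y) by move=> a Y Z; rewrite linearP.
rewrite (superop_exp_scalar X s lT ltr).
have E (a : R^nat) : (forall k, a k.+1 = 0) -> exp_series a s = a 0%N.
  move=> a0; apply: lim_near_cst => //; near=> N.
  have -> : N = N.-1.+1 by rewrite prednK//; near: N; exact: nbhs_infty_gt.
  rewrite /series /= big_nat_recl//= expr0 fact0 divr1 mul1r big1 ?addr0// => k _.
  by rewrite a0 mulr0.
by rewrite !E /= => [|k|k]; rewrite ?trT //; case: (\tr X).
Unshelve. all: by end_near.
Qed.

Lemma superop_exp_herm T X s : (forall Y, Y^t* = Y -> (T Y)^t* = T Y) -> X^t* = X ->
  (superop_exp T s X)^t* = superop_exp T s X.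
Proof.
move=> hT hX; apply: mx_lift_herm => [f|N]; first exact: lim_opp.
have hk k : (iter k T X)^t* = iter k T X by elim: k => //= k IH; exact: hT.
apply/matrixP => i j; rewrite trmxC_E !summxE raddf_sum; apply: eq_bigr => k _.
by rewrite !mxE /= conjc_realM -[in RHS](hk k) trmxC_E.
Qed.

(** The shifted sequence [phi (T^(k+1) X)] is the sequence of the form [phi] after [T], so the
    derivative is again a series covered by [superop_exp_scalar]. *)
Lemma is_derive_superop_exp T X s (phi : 'M[C]_m -> C) : linear T -> scalar phi ->
  is_derive s (1 : R) (fun s => complex.Re (phi (superop_exp T s X)))
    (complex.Re (phi (T (superop_exp T s X)))) /\
  is_derive s (1 : R) (fun s => complex.Im (phi (superop_exp T s X)))
    (complex.Im (phi (T (superop_exp T s X)))).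
Proof.
move=> lT lphi.
have lphiT : scalar (fun Y => phi (T Y)) by move=> a Y Z; rewrite lT lphi.
rewrite (superop_exp_scalar X s lT lphiT) /=.
have [K K0 /(_ _ lphi)[M M0 HM]] := iter_entry_bounded X lT.
split.
  under eq_fun do rewrite superop_exp_scalar//=.
  by apply: (@is_derive_exp_series _ _ _ K M) => // k; case: (HM k).
under eq_fun do rewrite superop_exp_scalar//=.
by apply: (@is_derive_exp_series _ _ _ K M) => // k; case: (HM k).
Qed.

(** Supplies what the termwise limit in [exp_series_ge0] asks for: a majorant uniform in [e], and a
    deviation of order [e] for each fixed power. *)
Lemma iter_perturbation (L Q : 'M[C]_m -> 'M[C]_m) (e0 : R) X :
  linear L -> linear Q -> 0 <= e0 ->
  exists2 K : R, 0 <= K &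
    (forall e k, 0 <= e <= e0 ->
      mxnorm1 (iter k (fun Y => L Y + e%:C *: Q Y) X) <= mxnorm1 X * K ^+ k) /\
    (forall k, exists B : R, forall e, 0 <= e <= e0 ->
      mxnorm1 (iter k (fun Y => L Y + e%:C *: Q Y) X - iter k L X) <= e * B).
Proof.
move=> lL lQ e00.
have [KL KL0 HL] := linear_bounded lL; have [KQ KQ0 HQ] := linear_bounded lQ.
have cR e : 0 <= e -> cnorm1 (e%:C : C) = e.
  by move=> ?; rewrite /cnorm1 /= normr0 addr0 ger0_norm.
have Hb e Y : 0 <= e <= e0 -> mxnorm1 (L Y + e%:C *: Q Y) <= (KL + e0 * KQ) * mxnorm1 Y.
  move=> /andP[e_ge0 ee0]; rewrite (le_trans (mxnorm1D _ _))// mulrDl lerD//.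
  rewrite (le_trans (mxnorm1Z _ _))// cR// -mulrA ler_pM// mxnorm1_ge0//.
have K0 : 0 <= KL + e0 * KQ by rewrite addr_ge0 ?mulr_ge0.
exists (KL + e0 * KQ) => //.
have H1 e k : 0 <= e <= e0 ->
    mxnorm1 (iter k (fun Y => L Y + e%:C *: Q Y) X) <= mxnorm1 X * (KL + e0 * KQ) ^+ k.
  by move=> he; apply: iter_bounded => // Y; exact: Hb.
split=> //; elim=> [|k [B IH]].
  exists 0 => e _ /=; rewrite subrr mulr0 /mxnorm1 big1// => i _.
  by rewrite big1// => j _; rewrite mxE /cnorm1 /= normr0 addr0.
exists (KL * B + KQ * (mxnorm1 X * (KL + e0 * KQ) ^+ k)) => e he.
rewrite !iterS; set Y := iter k _ X; set Y' := iter k L X.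
(* The error is the previous error propagated by [L] plus one fresh term [e Q Y], whence the
   recursion behind the witness. *)
have -> : L Y + e%:C *: Q Y - L Y' = L (Y - Y') + e%:C *: Q Y.
  have -> : L (Y - Y') = L Y - L Y' by rewrite addrC -scaleN1r lL scaleN1r addrC.
  by rewrite addrAC.
rewrite (le_trans (mxnorm1D _ _))// mulrDr; apply: lerD.
  by rewrite (le_trans (HL _))// mulrCA ler_wpM2l// IH.
have e_ge0 : 0 <= e by case/andP: he.
rewrite (le_trans (mxnorm1Z _ _))// cR// ler_wpM2l// (le_trans (HQ _))//.
by rewrite ler_wpM2l// H1.
Qed.

(** The identity commutes with [A], so Pascal's rule gives the binomial theorem for powers of a map
    close to the identity. *)
Lemma iter_id_add (A : 'M[C]_m -> 'M[C]_m) (e : C) : linear A -> forall N X,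
  iter N (fun Y => Y + e *: A Y) X =
  \sum_(0 <= k < N.+1) ('C(N, k)%:R * e ^+ k) *: iter k A X.
Proof.
move=> lA; elim=> [|N IH] X.
  by rewrite big_nat1 expr0 mulr1 /= scale1r.
rewrite iterS IH.
pose AL : {linear 'M[C]_m -> 'M[C]_m} := HB.pack A (GRing.isLinear.Build _ _ _ _ A lA).
rewrite -[A (\sum_(_ <= _ < _) _)]/(AL _) linear_sum /=.
rewrite [RHS]big_nat_recl//= bin0 [X in X + _ = _]big_nat_recl//= bin0 -addrA; congr (_ + _).
under [RHS]eq_bigr do rewrite binS natrD mulrDl scalerDl.
rewrite big_split /=; congr (_ + _).
  by rewrite [RHS]big_nat_recr//= bin_small// mul0r scale0r addr0.
rewrite scaler_sumr; apply: eq_bigr => k _.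
rewrite -[A _]/(AL _) linearZ /= scalerA exprS.
by congr (_ *: _); ring.
Qed.

End SuperoperatorExponential.

(** * Positive matrices and the trace norm *)

Section PositiveMatrices.
Variable R : realType.
Local Notation C := R[i].

Lemma trmxC_mul m n p (A : 'M[C]_(m, n)) (B : 'M[C]_(n, p)) :
  (A *m B)^t* = B^t* *m A^t*.
Proof. by rewrite trmx_mul map_mxM. Qed.

Lemma trmxCD m n (A B : 'M[C]_(m, n)) : (A + B)^t* = A^t* + B^t*.
Proof. by rewrite linearD map_mxD. Qed.

Lemma trmxCN m n (A : 'M[C]_(m, n)) : (- A)^t* = - A^t*.
Proof. by rewrite linearN map_mxN. Qed.

Lemma trmxCZ m n a (A : 'M[C]_(m, n)) : (a *: A)^t* = a^* *: A^t*.
Proof. by rewrite linearZ map_mxZ. Qed.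

Lemma trmxC_realZ m n (a : R) (A : 'M[C]_(m, n)) : (a%:C *: A)^t* = a%:C *: A^t*.
Proof. by rewrite linearZ map_mxZ; congr (_ *: _); exact: conjc_real. Qed.

Lemma trmxC1 m : (1%:M : 'M[C]_m)^t* = 1%:M.
Proof. by rewrite trmx1 map_mx1. Qed.

Lemma trmxC_sum m n (J : Type) (s : seq J) (Q : pred J) (F : J -> 'M[C]_(m, n)) :
  (\sum_(j <- s | Q j) F j)^t* = \sum_(j <- s | Q j) (F j)^t*.
Proof.
apply: (big_morph (fun A : 'M[C]_(m, n) => A^t*)); first exact: trmxCD.
by rewrite linear0 map_mx0.
Qed.

Lemma ge0_complexE (z : C) : (0 <= z) = (complex.Im z == 0) && (0 <= complex.Re z).
Proof. by rewrite lecE. Qed.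

(** Read as a linear form in [X] at fixed [v]: positivity becomes a family of scalar inequalities,
    which survive integrals and series. *)
Definition qform m (v : 'cV[C]_m) (X : 'M[C]_m) : C := (v^t* *m X *m v) 0 0.

Lemma qform_scalar m (v : 'cV[C]_m) : scalar (qform v).
Proof.
by move=> a X Y; rewrite /qform mulmxDr mulmxDl -scalemxAr -scalemxAl !mxE.
Qed.

Lemma qform_congr m p (v : 'cV[C]_p) (B : 'M[C]_(p, m)) (X : 'M[C]_m) :
  qform v (B *m X *m B^t*) = qform (B^t* *m v) X.
Proof. by rewrite /qform trmxC_mul trmxCK !mulmxA. Qed.

Lemma qform_herm m (v : 'cV[C]_m) (X : 'M[C]_m) : X^t* = X -> complex.Im (qform v X) = 0.
Proof.
move=> hX; have : (qform v X)^* = qform v X.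
  by rewrite /qform -trmxC_E !trmxC_mul trmxCK hX mulmxA.
case: (qform v X) => x y /eqP; rewrite eq_complex /= => /andP[_ /eqP]; lra.
Qed.

Lemma psdmxD m (A B : 'M[C]_m) : psdmx A -> psdmx B -> psdmx (A + B).
Proof. by move=> hA hB v; rewrite mulmxDr mulmxDl mxE addr_ge0. Qed.

Lemma psdmxZ m (a : R) (A : 'M[C]_m) : 0 <= a -> psdmx A -> psdmx (a%:C *: A).
Proof.
move=> a0 hA v; rewrite -scalemxAr -scalemxAl mxE mulr_ge0//.
by rewrite ler0c.
Qed.

Lemma psdmx_congr m p (B : 'M[C]_(p, m)) (A : 'M[C]_m) : psdmx A -> psdmx (B *m A *m B^t*).
Proof. by move=> hA v; rewrite -/(qform _ _) qform_congr; exact: hA. Qed.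

Lemma psdmx_sum m (J : Type) (s : seq J) (F : J -> 'M[C]_m) :
  (forall j, psdmx (F j)) -> psdmx (\sum_(j <- s) F j).
Proof.
move=> hF; elim: s => [|j s IH]; last by rewrite big_cons; exact: psdmxD.
by rewrite big_nil => v; rewrite mulmx0 mul0mx mxE.
Qed.

Lemma psdmx_diag m (A : 'M[C]_m) i : psdmx A -> 0 <= complex.Re (A i i).
Proof.
move=> /(_ (delta_mx i 0)); rewrite ge0_complexE => /andP[_].
have -> : (delta_mx i 0 : 'cV[C]_m)^t* = delta_mx 0 i.
  by apply/matrixP => j k; rewrite !mxE andbC; case: (_ && _); rewrite ?rmorph1 ?rmorph0.
by rewrite -rowE -colE !mxE.
Qed.

(** In an eigenbasis of [X = A - B], each eigenvalue is a difference of diagonal entries of [A] and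
    [B], both nonnegative, so its modulus is at most their sum; summing gives the traces. Most of
    the proof identifies the trace norm with the sum of the moduli of these eigenvalues. *)
Lemma trace_norm_psdB m (A B : 'M[C]_m) : A^t* = A -> B^t* = B -> psdmx A -> psdmx B ->
  trace_norm (A - B) <= complex.Re (\tr A) + complex.Re (\tr B).
Proof.
move=> hA hB pA pB; set X := A - B.
have hX : X^t* = X by rewrite trmxCD trmxCN hA hB.
have hXX : (X^t* *m X) \is hermsymmx by apply/hermP; rewrite trmxC_mul trmxCK.
have /orthomx_spectralP eX : X \is normalmx by apply/hermitian_normalmx/hermP.
have /orthomx_spectralP eXX := hermitian_normalmx hXX.
have /hermP/hermitian_spectral_diag_real/mxOverP dreal := hX.
have Uu := spectral_unitarymx X; have Vu := spectral_unitarymx (X^t* *m X).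
rewrite /trace_norm; rewrite !invmx_unitary// in eX eXX.
move: Uu Vu eX eXX dreal; set U := spectralmx X; set V := spectralmx _.
set d := spectral_diag X; set s := spectral_diag _.
move=> Uu Vu eX eXX dreal.
have UU : U *m U^t* = 1%:M by exact/unitarymxP.
have VV : V *m V^t* = 1%:M by exact/unitarymxP.
have UU' : U^t* *m U = 1%:M by exact: mulmx1C.
have VV' : V^t* *m V = 1%:M by exact: mulmx1C.
(* Change of basis between the chosen eigenbases of [X] and of [X'X]; the latter need not
   diagonalise [X]. *)
pose W := V *m U^t*.
have WW : W *m W^t* = 1%:M.
  by rewrite trmxC_mul trmxCK mulmxA -(mulmxA V) UU' mulmx1.
have WW' : W^t* *m W = 1%:M by exact: mulmx1C.
have sW : diag_mx s *m W = W *m diag_mx d *m diag_mx d.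
  have -> : diag_mx s = V *m (X *m X) *m V^t*.
    by rewrite -{1}hX eXX !mulmxA VV mul1mx -!mulmxA VV mulmx1.
  have XU : X *m U^t* = U^t* *m diag_mx d by rewrite {1}eX -!mulmxA UU mulmx1.
  rewrite /W -!mulmxA (mulmxA (V^t*)) VV' mul1mx XU (mulmxA X) XU.
  by rewrite !mulmxA.
clearbody W.
(* The squared moduli of the entries of a unitary matrix are doubly stochastic; they replace a
   permutation matching the two spectra. *)
pose n i j := complex.Re (W i j * (W i j)^*).
have n0 i j : 0 <= n i j.
  by rewrite /n; have := mulcJ_ge0 (W i j); rewrite ge0_complexE => /andP[].
have nrow i : \sum_j n i j = 1.
  have := congr1 (fun M : 'M[C]_m => complex.Re (M i i)) WW.
  rewrite [1%:M]lock !mxE -lock mxE eqxx /= raddf_sum => <-.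
  by apply: eq_bigr => j _; rewrite trmxC_E.
have ncol j : \sum_i n i j = 1.
  have := congr1 (fun M : 'M[C]_m => complex.Re (M j j)) WW'.
  rewrite [1%:M]lock !mxE -lock mxE eqxx /= raddf_sum => <-.
  by apply: eq_bigr => i _; rewrite trmxC_E /n mulrC.
have dR j : d 0 j = (complex.Re (d 0 j))%:C by rewrite RRe_real.
(* The intertwining relation [sW] forces [s_i = d_j^2] wherever [W i j] is nonzero; elsewhere both
   sides vanish. *)
have key i j : Num.sqrt (complex.Re (s 0 i)) * n i j = `|complex.Re (d 0 j)| * n i j.
  have [W0|W0] := eqVneq (W i j) 0; first by rewrite /n W0 mul0r /= !mulr0.
  congr (_ * _).
  have := congr1 (fun M : 'M[C]_m => M i j) sW.
  rewrite mul_diag_mx !mul_mx_diag !mxE -mulrA mulrC => /(mulfI W0) ->.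
  rewrite dR -rmorphM /= -expr2; exact: sqrtr_sqr.
have -> : \sum_i Num.sqrt (complex.Re (s 0 i)) = \sum_j `|complex.Re (d 0 j)|.
  transitivity (\sum_i \sum_j Num.sqrt (complex.Re (s 0 i)) * n i j).
    by apply: eq_bigr => i _; rewrite -mulr_sumr nrow mulr1.
  rewrite exchange_big; apply: eq_bigr => j _.
  by rewrite (eq_bigr _ (fun i _ => key i j)) -mulr_sumr ncol mulr1.
have trU (Y : 'M[C]_m) : \tr Y = \tr (U *m Y *m U^t*).
  by rewrite mxtrace_mulC mulmxA UU' mul1mx.
rewrite (trU A) (trU B) !raddf_sum -big_split /=; apply: ler_sum => j _.
have -> : d 0 j = (U *m A *m U^t*) j j - (U *m B *m U^t*) j j.
  have -> : (U *m A *m U^t*) j j - (U *m B *m U^t*) j j = (U *m X *m U^t*) j j.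
    by rewrite mulmxBr mulmxBl !mxE.
  by rewrite eX !mulmxA UU mul1mx -!mulmxA UU mulmx1 mxE eqxx.
rewrite raddfB /= (le_trans (ler_normB _ _))// !ger0_norm//.
  by apply: psdmx_diag; exact: psdmx_congr.
by apply: psdmx_diag; exact: psdmx_congr.
Qed.

(* With [G'] the adjoint of [G],
   [X + e (L X + e G X G') = e Phi X + (1 + e G) X (1 + e G)'] is a positive map
   of [X]; its powers with [e = s / N] expand binomially and tend to [exp (s L)]. *)
Lemma superop_exp_psd m (Phi L : 'M[C]_m -> 'M[C]_m) (G : 'M[C]_m) s X :
  linear L ->
  (forall Y, psdmx Y -> psdmx (Phi Y)) ->
  (forall Y, L Y = Phi Y + G *m Y + Y *m G^t*) ->
  (forall Y, Y^t* = Y -> (L Y)^t* = L Y) ->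
  0 <= s -> X^t* = X -> psdmx X -> psdmx (superop_exp L s X).
Proof.
move=> lL pPhi LE hL s0 hX pX v; rewrite -/(qform v _) ge0_complexE.
rewrite qform_herm ?eqxx/=; last exact: superop_exp_herm.
rewrite (superop_exp_scalar X s lL (qform_scalar v)) /=.
pose Q Y := G *m Y *m G^t*.
have lQ : linear Q by move=> a Y Z; rewrite /Q mulmxDr mulmxDl -scalemxAr -scalemxAl.
pose A (e : R) Y := L Y + e%:C *: Q Y.
have lA e : linear (A e).
  by move=> a Y Z; rewrite /A lL lQ scalerDr scalerDr !scalerA addrACA [e%:C * a]mulrC.
have [K K0 [HK HB]] := iter_perturbation X lL lQ s0.
have [B B0 Hphi] := scalar_bounded (qform_scalar v).
have Re_le Y : `|complex.Re (qform v Y)| <= B * mxnorm1 Y.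
  by rewrite (le_trans _ (Hphi Y))// /cnorm1 lerDl.
(* The step sizes stay in [[0, s]], the range on which the majorant of [iter_perturbation] is
   uniform. *)
have eN N : 0 <= s / N.+1%:R <= s.
  by rewrite divr_ge0//= ler_pdivrMr// ler_peMr// ler1n.
pose a N k := complex.Re (qform v (iter k (A (s / N.+1%:R)) X)).
apply: (@exp_series_ge0 _ a _ _ K (B * mxnorm1 X)) => //.
- by rewrite mulr_ge0// mxnorm1_ge0.
- by move=> N k; rewrite (le_trans (Re_le _))// -mulrA ler_wpM2l// HK.
- move=> k; have [b Hb] := HB k.
  apply/cvgrPdist_le => eps eps0.
  have : (fun N => (s * B * b) * N.+1%:R^-1 : R) @ \oo --> (s * B * b) * 0.
    by apply: cvgM; [exact: cvg_cst|exact: cvg_harmonic].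
  rewrite mulr0 => /cvgrPdist_le/(_ _ eps0); apply: filterS => N.
  rewrite sub0r normrN => /(le_trans (ler_norm _)); apply: le_trans.
  rewrite distrC /a -raddfB /=.
  have -> : qform v (iter k (A (s / N.+1%:R)) X) - qform v (iter k L X)
    = qform v (iter k (A (s / N.+1%:R)) X - iter k L X).
    by rewrite /qform mulmxBr mulmxBl !mxE.
  rewrite (le_trans (Re_le _))//.
  have -> : s * B * b / N.+1%:R = B * (s / N.+1%:R * b) by ring.
  by rewrite ler_wpM2l// Hb.
move=> N; set e := s / N.+1%:R.
have e0 : 0 <= e by case/andP: (eN N).
have pstep Y : psdmx Y -> psdmx (Y + e%:C *: A e Y).
  move=> pY.
  have -> : Y + e%:C *: A e Y =
      e%:C *: Phi Y + (1%:M + e%:C *: G) *m Y *m (1%:M + e%:C *: G)^t*.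
    have expand (E : 'M[C]_m) : (1%:M + E) *m Y *m (1%:M + E)^t* =
        Y + (E *m Y + Y *m E^t* + E *m Y *m E^t*).
      rewrite trmxCD trmxC1 !mulmxDl !mulmxDr mul1mx !mulmx1.
      by rewrite -!addrA; congr (_ + _); rewrite addrCA.
    rewrite (expand (e%:C *: G)) trmxC_realZ /A LE /Q.
    rewrite -!scalemxAl -!scalemxAr !scalerDr -!addrA.
    by rewrite [RHS]addrCA.
  by apply: psdmxD; [exact: psdmxZ (pPhi _ pY)|exact: psdmx_congr].
have pit n : psdmx (iter n (fun Y => Y + e%:C *: A e Y) X).
  by elim: n => //= n IH; exact: pstep.
have := pit N.+1 v; rewrite -/(qform v _) ge0_complexE => /andP[_].
rewrite iter_id_add//.
pose fL : {scalar 'M[C]_m} := HB.pack (qform v) (GRing.isLinear.Build _ _ _ _ (qform v) (qform_scalar v)).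
rewrite -[qform v _]/(fL _) linear_sum raddf_sum /=.
congr (_ <= _); apply: eq_bigr => k _.
rewrite -[qform v _]/(fL _) linearZ /=.
have -> : 'C(N.+1, k)%:R * (e%:C : C) ^+ k = ('C(N.+1, k)%:R * e ^+ k)%:C.
  by rewrite -(rmorph_nat (real_complex R)) -rmorphXn -rmorphM.
by rewrite Re_mul /= mul0r subr0.
Qed.

End PositiveMatrices.

(** * Time averages of the semigroup *)

Section TimeAverage.
Variable R : realType.
Local Notation C := R[i].
Local Notation mu := (@lebesgue_measure R).

(** Integrability is bundled with the value because [Rintegral] is additive only on integrable
    functions. *)
Definition int_rel (D : set R) (f : R -> R) (a : R) :=
  mu.-integrable D (EFin \o f) /\ Rintegral mu D f = a.

Lemma linrel_int_rel (D : set (measurableTypeR R)) : measurable D -> linrel (int_rel D).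
Proof.
move=> mD; split=> [|u v a b [iu <-] [iv <-]|u a c [iu <-]].
- by split; [exact: integrable0|rewrite Rintegral_cst// mul0r].
- split; last by rewrite RintegralD.
  exact: (integrableD mD iu iv).
- by split; [exact: (integrableZl mD c iu)|rewrite RintegralZl].
Qed.

Lemma mx_integral_mxrel D m (F : R -> 'M[C]_m) :
  (forall i j, mu.-integrable D (EFin \o (fun x => complex.Re (F x i j))) /\
               mu.-integrable D (EFin \o (fun x => complex.Im (F x i j)))) ->
  mxrel (int_rel D) F (mx_integral D F).
Proof. by move=> iF i j; rewrite mxE; case: (iF i j). Qed.

Lemma is_derive_continuous (F dF : R -> R) :
  (forall x, is_derive x (1 : R) F (dF x)) -> continuous F.
Proof.
move=> H x; apply: differentiable_continuous; apply/derivable1_diffP.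
by case: (H x).
Qed.

Lemma Rintegral_derive (F f : R -> R) a b : a < b ->
  (forall x, is_derive x (1 : R) F (f x)) -> continuous f ->
  Rintegral mu `[a, b] f = F b - F a.
Proof.
move=> ab HF cf; rewrite /Rintegral (@continuous_FTC2 _ f F a b)//.
- exact: continuous_subspaceT.
- have cF := is_derive_continuous HF.
  split.
  + by move=> x _; case: (HF x).
  + by apply: cvg_at_right_filter; exact: cF.
  + by apply: cvg_at_left_filter; exact: cF.
- by move=> x _; rewrite derive1E; case: (HF x).
Qed.

Variables (m : nat) (L Phi : 'M[C]_m -> 'M[C]_m) (G : 'M[C]_m).
Hypotheses (lL : linear L)
  (pPhi : forall Y, psdmx Y -> psdmx (Phi Y))
  (LE : forall Y, L Y = Phi Y + G *m Y + Y *m G^t*)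
  (hL : forall Y, Y^t* = Y -> (L Y)^t* = L Y)
  (trL : forall Y, \tr (L Y) = 0).

Lemma superop_exp_state s sigma : 0 <= s -> is_state sigma ->
  is_state (superop_exp L s sigma).
Proof.
move=> s0 [/hermP hs ps ts]; split.
- by apply/hermP; exact: superop_exp_herm.
- exact: (superop_exp_psd lL pPhi LE hL).
- by rewrite superop_exp_trace.
Qed.

Lemma superop_exp_integral X t : 0 < t ->
  mxrel (int_rel `[0, t]) (fun s => superop_exp L s X)
    (mx_integral `[0, t] (fun s => superop_exp L s X)).
Proof.
move=> t0; apply: mx_integral_mxrel => i j.
by split; apply: continuous_compact_integrable; do ?exact: segment_compact;
  apply: continuous_subspaceT; apply: is_derive_continuous => s;
  case: (is_derive_superop_exp X s lL (scalar_entry i j)) => d1 d2;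
  first [exact: d1|exact: d2].
Qed.

Lemma generator_integral X t : 0 < t ->
  L (mx_integral `[0, t] (fun s => superop_exp L s X)) = superop_exp L t X - X.
Proof.
move=> t0.
have lI : linrel (int_rel `[0, t]) by exact: linrel_int_rel.
have HL := mxrel_linear lI lL (superop_exp_integral X t0).
apply/matrixP => i j; have [[_ h1] [_ h2]] := HL i j.
have le : scalar (fun Y : 'M[C]_m => Y i j) by exact: scalar_entry.
have lLe : scalar (fun Y : 'M[C]_m => L Y i j) by move=> a Y Z; rewrite lL !mxE.
have d1 s := is_derive_superop_exp X s lL le.
(* Differentiating a second time, along the form [Y -> L Y i j], provides the continuity of the
   first derivative that the fundamental theorem of calculus asks for. *)
have d2 s := is_derive_superop_exp X s lL lLe.
have E0 := superop_exp0 X lL.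
apply/eqP; rewrite eq_complex -h1 -h2; apply/andP; split; apply/eqP.
  rewrite (Rintegral_derive t0 (fun s => (d1 s).1) (is_derive_continuous (fun s => (d2 s).1))).
  by rewrite E0 !mxE -raddfB.
rewrite (Rintegral_derive t0 (fun s => (d1 s).2) (is_derive_continuous (fun s => (d2 s).2))).
by rewrite E0 !mxE -raddfB.
Qed.

Lemma average_state sigma t : 0 < t -> is_state sigma ->
  is_state ((t^-1)%:C *: mx_integral `[0, t] (fun s => superop_exp L s sigma)).
Proof.
move=> t0 hsigma; set Z := mx_integral _ _.
have lI : linrel (int_rel `[0, t]) by exact: linrel_int_rel.
have HZ := superop_exp_integral sigma t0; rewrite -/Z in HZ.
have hZ : Z^t* = Z.
  apply: mx_lift_herm => [f|s]; first exact: Rintegral_opp.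
  by case: hsigma => /hermP hs _ _; exact: superop_exp_herm.
split.
- by apply/hermP; rewrite trmxC_realZ hZ.
- apply: psdmxZ; first by rewrite invr_ge0 ltW.
  move=> v; rewrite -/(qform v _) ge0_complexE qform_herm// eqxx/=.
  have [[_ <-] _] := mxrel_scalar lI (qform_scalar v) HZ.
  apply: Rintegral_ge0 => s /=; rewrite in_itv/= => /andP[s0 _].
  have [_ /(_ v) + _] := superop_exp_state s0 hsigma.
  by rewrite -/(qform v _) ge0_complexE => /andP[].
- rewrite linearZ /=.
  have ltr : scalar (fun Y : 'M[C]_m => \tr Y) by move=> a Y W; rewrite linearP.
  have [[_ h1] [_ h2]] := mxrel_scalar lI ltr HZ.
  have trE s : \tr (superop_exp L s sigma) = 1.
    by case: hsigma => _ _ ts; rewrite superop_exp_trace.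
  have -> : \tr Z = t%:C.
    apply/eqP; rewrite eq_complex /= -h1 -h2; apply/andP; split; apply/eqP.
      under eq_Rintegral do rewrite trE.
      rewrite Rintegral_cst//= mul1r lebesgue_measure_itv /= lte_fin t0.
      by rewrite oppr0 addr0.
    under eq_Rintegral do rewrite trE.
    by rewrite Rintegral_cst//= mul0r.
  by rewrite -rmorphM /= mulVf ?gt_eqF.
Qed.

Lemma average_trace_norm sigma t : 0 < t -> is_state sigma ->
  trace_norm (L ((t^-1)%:C *: mx_integral `[0, t] (fun s => superop_exp L s sigma)))
    <= 2 / t.
Proof.
move=> t0 hsigma; have [h1 p1 t1] := hsigma.
have [h2 p2 t2] := superop_exp_state (ltW t0) hsigma.
pose LL : {linear 'M[C]_m -> 'M[C]_m} := HB.pack L (GRing.isLinear.Build _ _ _ _ L lL).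
(* Distributing [1/t] leaves a difference of two positive matrices of trace [1/t] each, to which
   [trace_norm_psdB] applies. *)
rewrite -[L _]/(LL _) linearZ /= generator_integral// scalerBr.
have ti : 0 <= t^-1 by rewrite invr_ge0 ltW.
move/hermP: h1 => h1; move/hermP: h2 => h2.
apply: (le_trans (trace_norm_psdB _ _ _ _)); rewrite ?trmxC_realZ ?h1 ?h2//; try exact: psdmxZ.
rewrite !linearZ /= t1 t2 !mulr1 /=; lra.
Qed.

End TimeAverage.

(** * Gaussian Fourier transforms *)

Section Decay.
Variable R : realType.
Local Notation mu := (@lebesgue_measure R).
Implicit Types (f g h : R -> R).

(** The common majorant for the integrals over the whole line. *)
Lemma integrable_oneDsqrV : mu.-integrable setT (EFin \o (fun x : R => (oneDsqr x)^-1)).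
Proof.
have c1 : continuous (fun x : R => (oneDsqr x)^-1) := @continuous_oneDsqrV R.
apply/integrableP; split.
  by apply/measurable_EFinP; exact: continuous_measurable_fun.
under eq_integral => x _ do rewrite gee0_abs ?lee_fin ?invr_ge0 ?(ltW (oneDsqr_gt0 _))//=.
rewrite ge0_symfun_integralT//=.
- by rewrite -set_itvcy integral0y_oneDsqr -EFinM ltry.
- by move=> x /=; rewrite /oneDsqr sqrrN.
Qed.

Lemma integrable_le_oneDsqrV f c : measurable_fun setT f ->
  (forall x, `|f x| <= c * (oneDsqr x)^-1) -> mu.-integrable setT (EFin \o f).
Proof.
move=> mf fc.
apply: (@le_integrable _ _ _ mu setT measurableT _ (fun x => (c%:E * ((oneDsqr x)^-1)%:E)%E)).
- exact/measurable_EFinP.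
- by move=> x _ /=; rewrite lee_fin (le_trans (fc x))// ler_norm.
- exact: (@integrableZl _ _ _ mu setT measurableT c _ integrable_oneDsqrV).
Qed.

(** Decay of order [1/(1+|x|)] is what one integration by parts yields, and a product of two such
    functions is already integrable. *)
Definition decays f := measurable_fun setT f /\ exists c : R, forall x, `|f x| * (1 + `|x|) <= c.

Lemma linrel_decays : linrel (fun f (_ : R) => decays f).
Proof.
split=> [|f g _ _ [mf [c fc]] [mg [d gd]]|f _ a [mf [c fc]]].
- by split; [exact: measurable_cst|exists 0 => x; rewrite normr0 mul0r].
- split; first exact: measurable_funD.
  exists (c + d) => x; rewrite (le_trans _ (lerD (fc x) (gd x)))//.
  by rewrite -mulrDl ler_wpM2r ?addr_ge0// ler_normD.
- split; first by apply: measurable_funM => //; exact: measurable_cst.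
  by exists (`|a| * c) => x; rewrite normrM -mulrA ler_wpM2l.
Qed.

(** Rests on [1 + |x| <= (1 + |a - x|)(1 + |a|)]. It serves for the translates of the transform to
    the differences of eigenvalues. *)
Lemma decays_reflect f a : decays f -> decays (fun x => f (a - x)).
Proof.
move=> [mf [c fc]]; split.
  apply: (measurableT_comp mf); apply: measurable_funB => //; exact: measurable_cst.
exists (c * (1 + `|a|)) => x.
apply: (@le_trans _ _ (`|f (a - x)| * (1 + `|a - x|) * (1 + `|a|))).
  rewrite -mulrA ler_wpM2l//.
  have : `|x| <= `|a - x| + `|a|.
    by rewrite -[X in `|X| <= _](subKr a) (le_trans (ler_normB _ _))// addrC.
  have : 0 <= `|a - x| * `|a| by rewrite mulr_ge0.
  by rewrite mulrDl mul1r mulrDr mulr1; lra.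
by rewrite ler_wpM2r ?addr_ge0.
Qed.

(** Since [1 + x^2 <= (1 + |x|)^2], the two decaying factors give the majorant [1/(1 + x^2)], while
    [h], later the transition weight, is merely bounded. *)
Lemma integrable_decaysM f g h b : decays f -> decays g -> measurable_fun setT h ->
  (forall x, `|h x| <= b) -> mu.-integrable setT (EFin \o (fun x => h x * (f x * g x))).
Proof.
move=> [mf [c fc]] [mg [d gd]] mh hb.
apply: (@integrable_le_oneDsqrV _ (b * (c * d))).
  by apply: measurable_funM => //; exact: measurable_funM.
move=> x; rewrite ler_pdivlMr ?oneDsqr_gt0// !normrM -!mulrA.
have o0 : 0 <= oneDsqr x by rewrite ltW// oneDsqr_gt0.
apply: ler_pM; rewrite ?mulr_ge0//.
apply: (@le_trans _ _ ((`|f x| * (1 + `|x|)) * (`|g x| * (1 + `|x|)))).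
  rewrite mulrACA mulrA ler_wpM2l ?mulr_ge0//.
  have := normr_ge0 x; rewrite /oneDsqr -real_normK ?num_real// expr2 => x0.
  by rewrite mulrDl mul1r mulrDr mulr1; lra.
by apply: ler_pM; rewrite ?mulr_ge0 ?addr_ge0.
Qed.

End Decay.

Section GaussianFourier.
Variable R : realType.
Local Notation mu := (@lebesgue_measure R).
Variable a : R.
Hypothesis a0 : 0 < a.

Let phi (t : R) : R := expR (- (a * t ^+ 2)).
Let dphi (t : R) : R := - (2 * a * t) * phi t.

Let phi0 t : 0 <= phi t. Proof. exact: expR_ge0. Qed.

Lemma gauss_decay : exists c : R, forall t, `|phi t| <= c * (oneDsqr t)^-1 /\
  `|dphi t| <= c * (oneDsqr t)^-1.
Proof.
(* Chosen so that [1 + t^2 <= k (1 + a t^2 / 2) <= k exp (a t^2 / 2)]; squaring gives [key]. *)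
pose k := 1 + 2 / a.
have k1 : 1 <= k by rewrite lerDl divr_ge0// ltW.
have key t : (1 + t ^+ 2) ^+ 2 * phi t <= k ^+ 2.
  rewrite /phi expRN ler_pdivrMr ?expR_gt0//.
  have -> : a * t ^+ 2 = a * t ^+ 2 / 2 + a * t ^+ 2 / 2 by lra.
  rewrite expRD -expr2 -exprMn; apply: lerXn2r; rewrite ?nnegrE.
  - by rewrite addr_ge0 ?sqr_ge0.
  - by rewrite mulr_ge0 ?expR_ge0// (le_trans _ k1).
  - apply: (@le_trans _ _ (k * (1 + a * t ^+ 2 / 2))).
      have : 0 <= t ^+ 2 by exact: sqr_ge0.
      have -> : k * (1 + a * t ^+ 2 / 2) = 1 + t ^+ 2 + 2 / a + a * t ^+ 2 / 2.
        by rewrite /k; field; rewrite gt_eqF.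
      move=> t2; have : 0 <= 2 / a by rewrite divr_ge0// ltW.
      have : 0 <= a * t ^+ 2 / 2 by rewrite divr_ge0// mulr_ge0// ltW.
      lra.
    by rewrite ler_wpM2l ?(le_trans _ k1)// expR_ge1Dx.
(* [key] has one factor [1 + t^2] to spare: it is dropped for [phi], and for [dphi] it absorbs
   [|t|], leaving the constant [2 a]. *)
exists (k ^+ 2 * (1 + 2 * a)) => t.
have t2 : 1 <= 1 + t ^+ 2 by rewrite lerDl sqr_ge0.
have tt : `|t| <= 1 + t ^+ 2.
  have := sqr_ge0 (`|t| - 1); rewrite sqrrB real_normK ?num_real// mulr1 expr1n.
  have := normr_ge0 t; have := sqr_ge0 t; lra.
have k20 : 0 <= k ^+ 2 by rewrite exprn_ge0// (le_trans _ k1).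
rewrite !ler_pdivlMr ?oneDsqr_gt0// /oneDsqr; split.
  rewrite ger0_norm//; apply: (@le_trans _ _ (k ^+ 2)).
    rewrite (le_trans _ (key t))// mulrC ler_wpM2r// expr2 ler_peMl//.
    by rewrite (le_trans _ t2).
  by rewrite ler_peMr// lerDl mulr_ge0// ltW.
rewrite /dphi normrM normrN [`|phi t|]ger0_norm// !normrM [`|2|]ger0_norm// [`|a|]ger0_norm; last exact: ltW.
have p0 : 0 <= 1 + t ^+ 2 by rewrite (le_trans _ t2).
have H : `|t| * phi t * (1 + t ^+ 2) <= k ^+ 2.
  rewrite (le_trans _ (key t))// [in leRHS]expr2 -mulrA [phi t * _]mulrC mulrA.
  by rewrite ler_wpM2r// ler_wpM2r.
have -> : 2 * a * `|t| * phi t * (1 + t ^+ 2) = 2 * a * (`|t| * phi t * (1 + t ^+ 2)) by ring.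
apply: (@le_trans _ _ (2 * a * k ^+ 2)).
  by rewrite ler_wpM2l// mulr_ge0// ltW.
by rewrite mulrDr mulr1 [leRHS]addrC [k ^+ 2 * _]mulrC lerDl.
Qed.


Lemma is_derive_gauss t : is_derive t (1 : R) phi (dphi t).
Proof.
rewrite /phi /dphi; apply: is_derive_eq.
by rewrite /phi /GRing.scale /=; ring.
Qed.

Lemma continuous_gauss : continuous phi.
Proof. exact: is_derive_continuous is_derive_gauss. Qed.

Lemma continuous_dgauss : continuous dphi.
Proof.
by move=> t; apply: cvgM; [apply: cvgN; apply: cvgMl_tmp; exact: cvg_id|exact: continuous_gauss].
Qed.

Lemma integrable_gauss : mu.-integrable setT (EFin \o phi).
Proof.
have [c Hc] := gauss_decay; apply: (@integrable_le_oneDsqrV _ _ c) => [|t].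
  by apply: continuous_measurable_fun; exact: continuous_gauss.
by case: (Hc t).
Qed.

Lemma integrable_dgauss : mu.-integrable setT (EFin \o dphi).
Proof.
have [c Hc] := gauss_decay; apply: (@integrable_le_oneDsqrV _ _ c) => [|t].
  by apply: continuous_measurable_fun; exact: continuous_dgauss.
by case: (Hc t).
Qed.

End GaussianFourier.

Section WholeLine.
Variable R : realType.
Local Notation mu := (@lebesgue_measure R).

(** Over [[-N, N]] the integral is [F(N) - F(-N)], which tends to 0; dominated convergence reaches
    the whole line. *)
Lemma Rintegral_derive_eq0 (F f : R -> R) c :
  (forall x, is_derive x (1 : R) F (f x)) -> continuous f ->
  mu.-integrable setT (EFin \o f) -> (forall x, `|F x| <= c * (oneDsqr x)^-1) ->
  Rintegral mu setT f = 0.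
Proof.
move=> HF cf intf Fc.
have c0 : 0 <= c.
  have := le_trans (normr_ge0 _) (Fc 0).
  by rewrite /oneDsqr expr0n addr0 invr1 mulr1.
(* The successor keeps the interval nondegenerate, as [Rintegral_derive] requires. *)
pose D n : set R := `[- n.+1%:R, n.+1%:R]%classic.
have mD n : measurable (D n : set (measurableTypeR R)) by exact: measurable_itv.
have mf : measurable_fun setT f by exact: continuous_measurable_fun.
pose f_ n : R -> \bar R := EFin \o (f \_ (D n)).
have Hcv : (\int[mu]_(x in setT) f_ n x)%E @[n --> \oo] --> (\int[mu]_(x in setT) (f x)%:E)%E.
  have [] // := @dominated_convergence _ _ _ mu setT measurableT f_ (EFin \o f) (EFin \o (fun x => `|f x|)).
  - move=> n; apply/measurable_EFinP; apply/(measurable_restrictT f (mD n)).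
    exact: measurable_funTS.
  - exact/measurable_EFinP.
  - apply: aeW => x _; apply: cvg_near_cst; near=> n.
    rewrite /f_ /= patchE mem_set// /D /= in_itv /= -ler_norml.
    have xN := archi_boundP (normr_ge0 x).
    rewrite (le_trans (ltW xN))// ler_nat leqW//; near: n; exact: nbhs_infty_ge.
  - exact: integrable_norm.
  - apply: aeW => x n _; rewrite /f_ /= lee_fin patchE.
    by case: ifP => // _; rewrite normr0.
have Hn n : (\int[mu]_(x in setT) f_ n x)%E = (F n.+1%:R - F (- n.+1%:R))%:E.
  have iD : mu.-integrable (D n) (EFin \o f) by exact: (integrableS measurableT (mD n)).
  rewrite -(Rintegral_derive _ HF cf); last first.
    by rewrite (@lt_trans _ _ 0)// ltrNl oppr0.
  rewrite /Rintegral fineK; last exact: integrable_fin_num.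
  rewrite [RHS]integral_mkcond; apply: eq_integral => x _.
  by rewrite /f_ restrict_EFin.
have H0 : (F n.+1%:R - F (- n.+1%:R))%:E @[n --> \oo] --> (0%:E : \bar R).
  apply: cvg_EFin; first exact: nearW.
  apply/cvgr0Pnorm_le => e e0.
  have : (fun n => (2 * c) * n.+1%:R^-1 : R) @ \oo --> (2 * c) * 0.
    by apply: cvgM; [exact: cvg_cst|exact: cvg_harmonic].
  rewrite mulr0 => /cvgr0Pnorm_le/(_ _ e0); apply: filterS => n.
  apply: le_trans; rewrite (le_trans (ler_normB _ _))//.
  have Fn x : `|x| = n.+1%:R -> `|F x| <= c * n.+1%:R^-1.
    move=> xn; rewrite (le_trans (Fc _))// ler_wpM2l// lef_pV2 ?posrE ?oneDsqr_gt0//.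
    rewrite /oneDsqr -real_normK ?num_real// xn.
    by rewrite expr2 (@le_trans _ _ (n.+1%:R * n.+1%:R))// ?lerDr// ler_peMr// ler1n.
  rewrite [leRHS]ger0_norm ?mulr_ge0// (_ : 2 * c / _ = c * n.+1%:R^-1 + c * n.+1%:R^-1); last by ring.
  by apply: lerD; apply: Fn; rewrite ?normrN normr_nat.
rewrite /Rintegral (cvg_unique _ Hcv (_ : _ --> 0%:E))//.
by under eq_fun do rewrite Hn.
Unshelve. all: by end_near.
Qed.

End WholeLine.

(** * Decay of Gaussian sine and cosine transforms *)

Section GaussianFourierDecay.
Variable R : realType.
Local Notation mu := (@lebesgue_measure R).
Variable a : R.
Hypothesis a0 : 0 < a.

Let phi (t : R) : R := expR (- (a * t ^+ 2)).
Let dphi (t : R) : R := - (2 * a * t) * phi t.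

Lemma integrable_gaussM (u : R -> R) : continuous u -> (forall x, `|u x| <= 1) ->
  mu.-integrable setT (EFin \o (fun t => phi t * u t)) /\
  mu.-integrable setT (EFin \o (fun t => dphi t * u t)).
Proof.
move=> cu u1; have [c Hc] := gauss_decay a0.
have cp : continuous phi := @continuous_gauss R a.
have cdp : continuous dphi := @continuous_dgauss R a.
have H (w : R -> R) : continuous w -> (forall t, `|w t| <= c * (oneDsqr t)^-1) ->
    mu.-integrable setT (EFin \o (fun t => w t * u t)).
  move=> cw wc; apply: (@integrable_le_oneDsqrV _ _ c) => [|t].
    by apply: continuous_measurable_fun => x; apply: cvgM; [exact: cw|exact: cu].
  by rewrite normrM (le_trans _ (wc t))// ler_piMr.
by split; apply: H => // t; case: (Hc t).
Qed.

(** Integration by parts: the derivative of [phi t * v (x * t)] integrates to 0, so [x] times the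
    transform is minus the integral of [dphi t * v (x * t)], bounded in [x]. The pair [u], [v]
    covers cosine and sine at once. *)
Lemma decays_gauss_transform (u v : R -> R) :
  (forall x, is_derive x (1 : R) v (u x)) -> continuous u ->
  (forall x, `|u x| <= 1) -> (forall x, `|v x| <= 1) ->
  decays (fun x => Rintegral mu setT (fun t => phi t * u (x * t))).
Proof.
move=> duv cu u1 v1.
have cv := is_derive_continuous duv.
have cscale (w : R -> R) (x : R) : continuous w -> continuous (fun t : R => w (x * t)).
  by move=> cw t; apply: continuous_comp; [apply: cvgMl_tmp; exact: cvg_id|exact: cw].
have ip x : mu.-integrable setT (EFin \o (fun t => phi t * u (x * t))).
  by have [] := @integrable_gaussM (fun t => u (x * t)); [exact: cscale|by move=> t; exact: u1|].
have idp x : mu.-integrable setT (EFin \o (fun t => dphi t * v (x * t))).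
  by have [] := @integrable_gaussM (fun t => v (x * t)); [exact: cscale|by move=> t; exact: v1|].
have phi0 t : 0 <= phi t by exact: expR_ge0.
have cp : continuous phi := @continuous_gauss R a.
have cdp : continuous dphi := @continuous_dgauss R a.
split.
  apply: continuous_measurable_fun => x.
  have := @continuity_under_integral R _ _ mu (fun x t => phi t * u (x * t)) setT measurableT
    (x - 1) (x + 1) (fun x _ => ip x) _ phi (integrable_gauss a0).
  move=> /(_ (aeW _ _)) /(_ _) H.
  apply: H.
  - move=> t _ y _; apply: cvgM; first exact: cvg_cst.
    apply: (@continuous_comp _ _ _ (fun y : R => y * t) u); last exact: cu.
    by apply: cvgMr_tmp; exact: cvg_id.
  - move=> y _; apply: aeW => t _.
    by rewrite normrM ger0_norm// ler_piMr.
  - by rewrite inE/= in_itv/= ltrBlDr ltrDl ltr01.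
(* In [1 + |x|], the 1 costs the integral of [phi], and [|x|] costs that of [|dphi|], by the
   integration by parts. *)
exists (Rintegral mu setT phi + Rintegral mu setT (fun t => `|dphi t|)) => x.
have ia := integrable_gauss a0; have ida := integrable_dgauss a0.
rewrite mulrDr mulr1; apply: lerD.
  rewrite (le_trans (le_normr_Rintegral _ (ip x)))//.
  apply: le_Rintegral => //; first exact: integrable_norm.
  by move=> t _; rewrite normrM [`|phi t|]ger0_norm// ler_piMr.
have h0 : Rintegral mu setT (fun t => dphi t * v (x * t) + x * (phi t * u (x * t))) = 0.
  have [c Hc] := gauss_decay a0.
  apply: (@Rintegral_derive_eq0 _ (fun t => phi t * v (x * t)) _ c).
  - move=> t; have d1 : is_derive t (1 : R) phi (dphi t) := is_derive_gauss a t.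
    have d2 : is_derive t (1 : R) (fun t => v (x * t)) (u (x * t) * x).
      apply: (@is_derive1_comp _ v (fun t => x * t)).
      by apply: is_derive_eq; rewrite /GRing.scale /= mulr1.
    by apply: is_derive_eq; rewrite /GRing.scale /=; ring.
  - move=> t; apply: cvgD; first by apply: cvgM; [exact: cdp|exact: cscale].
    by apply: cvgM; [exact: cvg_cst|apply: cvgM; [exact: cp|exact: cscale]].
  - exact: (@integrableD _ _ _ mu setT measurableT _ _ (idp x) (@integrableZl _ _ _ mu setT measurableT x _ (ip x))).
  - move=> t; have [h1 _] := Hc t; rewrite normrM (le_trans _ h1)//.
    by rewrite ler_piMr.
have ixp := @integrableZl _ _ _ mu setT measurableT x _ (ip x).
rewrite (RintegralD _ (idp x) ixp)// RintegralZl// in h0.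
have -> : `|Rintegral mu setT (fun t => phi t * u (x * t))| * `|x| =
    `|Rintegral mu setT (fun t => dphi t * v (x * t))|.
  rewrite -normrM mulrC -normrN; congr `|_|; apply/eqP; rewrite eq_sym -subr_eq0 opprK.
  by apply/eqP.
rewrite (le_trans (le_normr_Rintegral _ (idp x)))//.
apply: le_Rintegral => //; try exact: integrable_norm.
by move=> t _; rewrite normrM ler_piMr.
Qed.

End GaussianFourierDecay.

(** * Spectral expansion of the Heisenberg evolution *)

Section SpectralExpansion.
Variable R : realType.
Local Notation C := R[i].

(** Shaped after [cos_coeff] and [sin_coeff], so that the partial sums of the exponential match
    theirs term by term. *)
Lemma expr_imag (x : R) k : (x *i : C) ^+ k =
  ((~~ odd k)%:R * (-1) ^+ k./2 * x ^+ k) +i* ((odd k)%:R * (-1) ^+ k.-1./2 * x ^+ k).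
Proof.
elim: k => [|k IH]; first by rewrite !expr0 !mul0r !mul1r.
rewrite exprS IH; apply/eqP; rewrite eq_complex /= !mul0r sub0r add0r negbK.
apply/andP; split; apply/eqP; last by rewrite [x ^+ k.+1]exprS; ring.
rewrite [x ^+ k.+1]exprS; case ok: (odd k); last by rewrite !mul0r mulr0 oppr0.
have -> : uphalf k = k.-1./2.+1 by case: k ok {IH} => //= k; case: (odd k).
by rewrite [(-1) ^+ _.+1]exprS; ring.
Qed.

Lemma cvg_cexpi (x : R) :
  crel (@seq_cvg R) (fun N => \sum_(0 <= k < N) ((k`!%:R : R)^-1)%:C * (x *i) ^+ k)
    (cexpi x).
Proof.
split => /=.
  under eq_fun do rewrite raddf_sum.
  rewrite (_ : (fun _ => _) = series (cos_coeff x)).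
    by rewrite /seq_cvg unlock; exact: is_cvg_series_cos_coeff.
  apply/funext => N; apply: eq_bigr => k _.
  by rewrite expr_imag /= mul0r subr0 /cos_coeff /= mulrC.
under eq_fun do rewrite raddf_sum.
rewrite (_ : (fun _ => _) = series (sin_coeff x)).
  by rewrite /seq_cvg unlock; exact: is_cvg_series_sin_coeff.
apply/funext => N; apply: eq_bigr => k _.
by rewrite expr_imag /= mul0r addr0 /sin_coeff /= mulrC.
Qed.

Lemma cexpiD (x y : R) : cexpi (x + y) = cexpi x * cexpi y.
Proof. by apply/eqP; rewrite eq_complex /= cosD sinD eqxx/= addrC. Qed.

Lemma mxrel_sumZ (T : Type) I (J : finType) m p (c : J -> T -> C) (z : J -> C)
    (B : J -> 'M[C]_(m, p)) : linrel I -> (forall j, crel I (c j) (z j)) ->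
  mxrel I (fun x => \sum_j c j x *: B j) (\sum_j z j *: B j).
Proof.
move=> lI cz i k; rewrite summxE; under eq_fun do rewrite summxE.
apply: crel_sum => // j; rewrite mxE; under eq_fun do rewrite mxE.
exact: crelZr.
Qed.

Variables (m : nat) (H : 'M[C]_m).
Hypothesis hH : H^t* = H.

Definition eigval p : R := complex.Re (spectral_diag H 0 p).
(** Rank-one spectral projections, indexed by position rather than by eigenvalue, so repeated
    eigenvalues stay separate. *)
Definition eigproj p : 'M[C]_m :=
  (spectralmx H)^t* *m delta_mx p p *m spectralmx H.

Lemma eigproj_sum (c : 'I_m -> C) : \sum_p c p *: eigproj p =
  (spectralmx H)^t* *m diag_mx (\row_p c p) *m spectralmx H.
Proof.
rewrite diag_mx_sum_delta mulmx_sumr mulmx_suml; apply: eq_bigr => p _.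
by rewrite mxE -scalemxAr -scalemxAl.
Qed.

Lemma eigproj_sumM (c d : 'I_m -> C) :
  (\sum_p c p *: eigproj p) *m (\sum_p d p *: eigproj p) =
  \sum_p (c p * d p) *: eigproj p.
Proof.
rewrite !eigproj_sum -!mulmxA [spectralmx H *m (_ *m _)]mulmxA.
rewrite (unitarymxP (spectral_unitarymx H)) mul1mx [diag_mx _ *m (_ *m _)]mulmxA mulmx_diag.
by congr (_ *m (diag_mx _ *m _)); apply/rowP => p; rewrite !mxE.
Qed.

Lemma eigproj_sum1 : \sum_p 1 *: eigproj p = 1%:M.
Proof.
rewrite eigproj_sum (_ : (\row_p 1) = const_mx 1); last by apply/rowP => p; rewrite !mxE.
rewrite diag_const_mx mulmx1; apply: mulmx1C.
exact: (unitarymxP (spectral_unitarymx H)).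
Qed.

Lemma spectral_decomposition : H = \sum_p (eigval p)%:C *: eigproj p.
Proof.
have hh : H \is hermsymmx by exact/hermP.
have /orthomx_spectralP eH := hermitian_normalmx hh.
have /mxOverP dreal := hermitian_spectral_diag_real hh.
rewrite invmx_unitary ?spectral_unitarymx// in eH.
rewrite {1}eH eigproj_sum; congr (_ *m diag_mx _ *m _).
by apply/rowP => p; rewrite !mxE /eigval RRe_real.
Qed.

Lemma mx_exp_spectral (t : R) :
  mx_exp ((t *i) *: H) = \sum_p cexpi (t * eigval p) *: eigproj p.
Proof.
have powE k : ((t *i) *: H) ^+ k = \sum_p ((t * eigval p) *i) ^+ k *: eigproj p.
  elim: k => [|k IH].
    by under eq_bigr do rewrite expr0; rewrite expr0 eigproj_sum1.
  rewrite exprS IH.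
  have -> : (t *i) *: H = \sum_p ((t * eigval p) *i) *: eigproj p.
    rewrite {1}spectral_decomposition scaler_sumr; apply: eq_bigr => p _.
    rewrite scalerA; congr (_ *: _); apply/eqP.
    by rewrite eq_complex /= !mul0r mulr0 subrr add0r !eqxx.
  rewrite -mulmxE eigproj_sumM; apply: eq_bigr => p _.
  by rewrite exprS.
apply: (@mx_lift_mxrel _ _ (@seq_cvg R)); first exact: seq_cvg_lim.
have H1 := mxrel_sumZ eigproj (linrel_seq_cvg R) (fun p => cvg_cexpi (t * eigval p)).
rewrite [X in mxrel _ X _](_ : _ = fun N => \sum_p
    (\sum_(0 <= k < N) ((k`!%:R : R)^-1)%:C * ((t * eigval p) *i) ^+ k) *: eigproj p) //.
apply/funext => N; under [RHS]eq_bigr do rewrite scaler_suml.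
rewrite exchange_big; apply: eq_bigr => k _ /=.
by rewrite powE scaler_sumr; apply: eq_bigr => p _; rewrite scalerA.
Qed.

(** The time dependence is confined to scalar phases at the differences of eigenvalues, which
    reduces the operator Fourier transform to scalar ones. *)
Lemma heisenberg_spectral (t : R) (A : 'M[C]_m) : heisenberg H t A =
  \sum_(pq : 'I_m * 'I_m) cexpi (t * (eigval pq.1 - eigval pq.2)) *:
    (eigproj pq.1 *m A *m eigproj pq.2).
Proof.
have tN : - (t *i : C) = (- t) *i.
  by apply/eqP; rewrite eq_complex /= oppr0 !eqxx.
rewrite /heisenberg ?tN !mx_exp_spectral !mulmx_suml.
rewrite (eq_bigr (fun p => \sum_q cexpi (t * (eigval p - eigval q)) *:
    (eigproj p *m A *m eigproj q))).
  by rewrite pair_big.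
move=> p _; rewrite mulmx_sumr; apply: eq_bigr => q _.
rewrite -!scalemxAl -scalemxAr scalerA -cexpiD; congr (cexpi _ *: _); ring.
Qed.

End SpectralExpansion.

(** * The thermal generator *)

Section ThermalGenerator.
Variables (R : realType) (beta kappa : R).
Local Notation C := R[i].
Local Notation mu := (@lebesgue_measure R).
Hypotheses (beta0 : 0 < beta) (kappa0 : 0 < kappa).

(** The integral of [f(t) e^(ixt)], that is the Fourier transform of the filter without its factor
    [1/sqrt(2 pi)]. *)
Definition filter_hat (x : R) : C :=
  Rintegral mu setT (fun t => gauss_filter kappa t * cos (x * t))
  +i* Rintegral mu setT (fun t => gauss_filter kappa t * sin (x * t)).

Let c0 : R := Num.sqrt (kappa * Num.sqrt (2 / pi)).
Let k2 : 0 < kappa ^+ 2. Proof. by rewrite exprn_gt0. Qed.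

Lemma gauss_filterE t : gauss_filter kappa t = c0 * expR (- (kappa ^+ 2 * t ^+ 2)).
Proof. by rewrite /gauss_filter mulrC. Qed.

Lemma integrable_filterM (u : R -> R) : continuous u -> (forall x, `|u x| <= 1) ->
  mu.-integrable setT (EFin \o (fun t => gauss_filter kappa t * u t)).
Proof.
move=> cu u1; have [iu _] := integrable_gaussM k2 cu u1.
rewrite (_ : (fun t => _) = fun t => c0 * (expR (- (kappa ^+ 2 * t ^+ 2)) * u t)).
  exact: (@integrableZl _ _ _ mu setT measurableT c0 _ iu).
by apply/funext => t; rewrite gauss_filterE mulrA.
Qed.

Lemma decays_filter_transform (u v : R -> R) :
  (forall x, is_derive x (1 : R) v (u x)) -> continuous u ->
  (forall x, `|u x| <= 1) -> (forall x, `|v x| <= 1) ->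
  decays (fun x => Rintegral mu setT (fun t => gauss_filter kappa t * u (x * t))).
Proof.
move=> duv cu u1 v1; have [_ _ dZ] := linrel_decays R.
have := dZ _ 0 c0 (decays_gauss_transform k2 duv cu u1 v1).
rewrite (_ : (fun x => _) = fun x => Rintegral mu setT (fun t => gauss_filter kappa t * u (x * t)))//.
apply/funext => x; rewrite -RintegralZl//.
  by apply: eq_Rintegral => t _; rewrite gauss_filterE mulrA.
have [] := @integrable_gaussM R _ k2 (fun t => u (x * t)) => //.
by move=> t; apply: continuous_comp; [apply: cvgMl_tmp; exact: cvg_id|exact: cu].
Qed.

Let cos_le1 (x : R) : `|cos x| <= 1.
Proof. by rewrite ler_norml cos_geN1 cos_le1. Qed.

Let sin_le1 (x : R) : `|sin x| <= 1.
Proof. by rewrite ler_norml sin_geN1 sin_le1. Qed.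

(* A class of functions is turned into a [linrel] by ignoring the value. *)
Definition decaysR (f : R -> R) (_ : R) := decays f.

Lemma decays_filter_hat (nu : R) : crel decaysR (fun w => filter_hat (nu - w)) 0.
Proof.
split; rewrite /decaysR.
  apply: (@decays_reflect _ (fun x => complex.Re (filter_hat x))).
  apply: (@decays_filter_transform (@cos R) (@sin R)) => //.
  exact: continuous_cos.
apply: (@decays_reflect _ (fun x => complex.Im (filter_hat x))).
apply: (@decays_filter_transform (@sin R) (fun x => - cos x : R)) => //.
  by move=> x; apply: is_derive_eq; rewrite opprK.
- exact: continuous_sin.
- by move=> x; rewrite normrN.
Qed.

Lemma filter_hat_rel (nu w : R) :
  crel (int_rel setT)
    (fun t => cexpi (- (w * t)) * (gauss_filter kappa t)%:C * cexpi (t * nu))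
    (filter_hat (nu - w)).
Proof.
have E t : cexpi (- (w * t)) * (gauss_filter kappa t)%:C * cexpi (t * nu) =
    (gauss_filter kappa t)%:C * cexpi ((nu - w) * t).
  rewrite mulrAC mulrC -cexpiD; congr (_ * cexpi _); ring.
under eq_fun do rewrite E.
have cs (u : R -> R) (x : R) : continuous u -> continuous (fun t : R => u (x * t)).
  by move=> cu t; apply: continuous_comp; [apply: cvgMl_tmp; exact: cvg_id|exact: cu].
split => /=; split; rewrite /=.
- rewrite (_ : (fun x => _) = fun t => gauss_filter kappa t * cos ((nu - w) * t)).
    by apply: integrable_filterM => //; apply: cs; exact: continuous_cos.
  by apply/funext => t; rewrite mul0r subr0.
- by apply: eq_Rintegral => t _; rewrite mul0r subr0.
- rewrite (_ : (fun x => _) = fun t => gauss_filter kappa t * sin ((nu - w) * t)).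
    by apply: integrable_filterM => //; apply: cs; exact: continuous_sin.
  by apply/funext => t; rewrite mul0r addr0.
- by apply: eq_Rintegral => t _; rewrite mul0r addr0.
Qed.

Lemma transition_weight_ge0 w : 0 <= transition_weight beta kappa w.
Proof. exact: expR_ge0. Qed.

Lemma transition_weight_le1 w : transition_weight beta kappa w <= 1.
Proof.
rewrite /transition_weight -expR0 ler_expR mulNr oppr_le0 mulr_ge0//; first exact: ltW.
by rewrite le_max lexx orbT.
Qed.

Lemma measurable_transition_weight : measurable_fun setT (transition_weight beta kappa).
Proof.
apply: measurableT_comp; first exact: measurable_expR.
apply: measurable_funM; first exact: measurable_cst.
apply: measurable_maxr; last exact: measurable_cst.
by apply: measurable_funD => //; exact: measurable_cst.
Qed.

Definition integrableR (f : R -> R) (_ : R) := mu.-integrable setT (EFin \o f).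

Lemma linrel_integrableR : linrel integrableR.
Proof.
have [h0 hD hZ] := @linrel_int_rel R setT measurableT.
split=> [|u v a b iu iv|u a c iu].
- by case: h0.
- by case: (hD u v _ _ (conj iu erefl) (conj iv erefl)).
- by case: (hZ u _ c (conj iu erefl)).
Qed.

Lemma weighted_product_integrable (f g : R -> C) z z' :
  crel decaysR f z -> crel decaysR g z' ->
  crel integrableR (fun w => (transition_weight beta kappa w)%:C * (f w * g w)) 0.
Proof.
move=> [fr fi] [gr gi].
have w1 x : `|transition_weight beta kappa x| <= 1.
  by rewrite ger0_norm ?transition_weight_le1// transition_weight_ge0.
have P u v (du : decays u) (dv : decays v) :=
  integrable_decaysM du dv measurable_transition_weight w1.
have [_ hD hZ] := linrel_integrableR.
split; rewrite /integrableR.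
  have := hD _ _ 0 0 (P _ _ fr gr) (hZ _ 0 (-1) (P _ _ fi gi)).
  rewrite /integrableR; congr (integrable _ _ (_ \o _)); apply/funext => x.
  by rewrite !Re_mul /=; ring.
have := hD _ _ 0 0 (P _ _ fr gi) (P _ _ fi gr).
rewrite /integrableR; congr (integrable _ _ (_ \o _)); apply/funext => x.
by rewrite !Im_mul /=; ring.
Qed.

Variables (m : nat) (H : 'M[C]_m).
Hypothesis hH : H^t* = H.

(** Integrating the Heisenberg expansion coefficientwise leaves [w] only in translates of
    [filter_hat]; the decay of [op_fourier] follows. *)
Lemma op_fourier_spectral (A : 'M[C]_m) (w : R) : op_fourier kappa H A w =
  ((Num.sqrt (2 * pi))^-1)%:C *: \sum_(pq : 'I_m * 'I_m)
    filter_hat (eigval H pq.1 - eigval H pq.2 - w) *: (eigproj H pq.1 *m A *m eigproj H pq.2).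
Proof.
rewrite /op_fourier; congr (_ *: _).
apply: (@mx_lift_mxrel _ _ (int_rel setT)); first by move=> f a; case.
have E t : (cexpi (- (w * t)) * (gauss_filter kappa t)%:C) *: heisenberg H t A =
    \sum_(pq : 'I_m * 'I_m) (cexpi (- (w * t)) * (gauss_filter kappa t)%:C *
      cexpi (t * (eigval H pq.1 - eigval H pq.2))) *: (eigproj H pq.1 *m A *m eigproj H pq.2).
  rewrite heisenberg_spectral// scaler_sumr; apply: eq_bigr => pq _.
  by rewrite scalerA.
under eq_fun do rewrite E.
apply: mxrel_sumZ => [|pq]; first exact: linrel_int_rel.
exact: filter_hat_rel.
Qed.

Lemma decays_op_fourier (A : 'M[C]_m) i j :
  crel decaysR (fun w => op_fourier kappa H A w i j) 0.
Proof.
have lI : linrel decaysR := linrel_decays R.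
under eq_fun do rewrite op_fourier_spectral.
have := mxrel_sumZ (fun pq : 'I_m * 'I_m => eigproj H pq.1 *m A *m eigproj H pq.2) lI
  (fun pq => decays_filter_hat (eigval H pq.1 - eigval H pq.2)).
by move=> /(mxrelZ lI ((Num.sqrt (2 * pi))^-1)%:C)/(_ i j).
Qed.

Lemma decays_conj (f : R -> C) z : crel decaysR f z -> crel decaysR (fun w => (f w)^*) z.
Proof. by move=> /(crel_conj (linrel_decays R)). Qed.

Local Notation gamma := (transition_weight beta kappa).

Section Jump.
Variable A : 'M[C]_m.
Local Notation Ah := (op_fourier kappa H A).

(** The gain part of the dissipator; [jump_rate] below is the operator in its anticommutator. *)
Definition jump_map (X : 'M[C]_m) : 'M[C]_m :=
  mx_integral setT (fun w => (gamma w)%:C *: (Ah w *m X *m (Ah w)^t*)).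

Definition jump_rate : 'M[C]_m :=
  mx_integral setT (fun w => (gamma w)%:C *: ((Ah w)^t* *m Ah w)).

Lemma jump_map_rel X : mxrel (int_rel setT)
  (fun w => (gamma w)%:C *: (Ah w *m X *m (Ah w)^t*)) (jump_map X).
Proof.
have lI := linrel_integrableR.
apply: mx_integral_mxrel => i j.
suff: crel integrableR (fun w => ((gamma w)%:C *: (Ah w *m X *m (Ah w)^t*)) i j) 0 by [].
have -> : (fun w => ((gamma w)%:C *: (Ah w *m X *m (Ah w)^t*)) i j) =
    fun w => \sum_l \sum_k ((gamma w)%:C * (Ah w i k * (Ah w j l)^*)) * X k l.
  apply/funext => w; rewrite !mxE mulr_sumr; apply: eq_bigr => l _.
  rewrite trmxC_E mxE mulr_suml mulr_sumr; apply: eq_bigr => k _; ring.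
apply: crel_sum0 => // l; apply: crel_sum0 => // k.
rewrite -[0](mul0r (X k l)); apply: crelZr => //.
apply: weighted_product_integrable; first exact: decays_op_fourier.
by apply: decays_conj; exact: decays_op_fourier.
Qed.

Lemma jump_rate_rel : mxrel (int_rel setT)
  (fun w => (gamma w)%:C *: ((Ah w)^t* *m Ah w)) jump_rate.
Proof.
have lI := linrel_integrableR.
apply: mx_integral_mxrel => i j.
suff: crel integrableR (fun w => ((gamma w)%:C *: ((Ah w)^t* *m Ah w)) i j) 0 by [].
have -> : (fun w => ((gamma w)%:C *: ((Ah w)^t* *m Ah w)) i j) =
    fun w => \sum_k (gamma w)%:C * ((Ah w k i)^* * Ah w k j).
  apply/funext => w; rewrite !mxE mulr_sumr; apply: eq_bigr => k _.
  by rewrite trmxC_E.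
apply: crel_sum0 => // k.
apply: weighted_product_integrable; last exact: decays_op_fourier.
by apply: decays_conj; exact: decays_op_fourier.
Qed.

Let lI : linrel (@int_rel R setT). Proof. exact: linrel_int_rel. Qed.

Let integral_rel F (Z : 'M[C]_m) : mxrel (int_rel setT) F Z -> mx_integral setT F = Z.
Proof. by apply: mx_lift_mxrel => f a; case. Qed.

Lemma jump_map_linear : linear jump_map.
Proof.
move=> a X Y; apply: integral_rel.
have := mxrelD lI (mxrelZ lI a (jump_map_rel X)) (jump_map_rel Y).
congr (mxrel _ _ _); apply/funext => w.
move: (Ah w) => F.
by rewrite mulmxDr mulmxDl -scalemxAr -scalemxAl scalerDr !scalerA mulrC.
Qed.

Lemma jump_map_psd X : psdmx X -> psdmx (jump_map X).
Proof.
move=> pX v; rewrite -/(qform v _) ge0_complexE.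
have [[_ h1] [_ h2]] := mxrel_scalar lI (qform_scalar v) (jump_map_rel X).
have key w : 0 <= qform v ((gamma w)%:C *: (Ah w *m X *m (Ah w)^t*)).
  exact: (psdmxZ (transition_weight_ge0 w) (psdmx_congr (Ah w) pX)).
rewrite -h1 -h2; apply/andP; split; last first.
  by apply: Rintegral_ge0 => w _; have := key w; rewrite ge0_complexE => /andP[].
apply/eqP; rewrite (@eq_Rintegral _ _ _ _ _ (fun=> 0)) ?Rintegral_cst ?mul0r//.
by move=> w _; have := key w; rewrite ge0_complexE => /andP[/eqP].
Qed.

Lemma jump_map_herm X : X^t* = X -> (jump_map X)^t* = jump_map X.
Proof.
move=> hX; apply: mx_lift_herm => [f|w]; first exact: Rintegral_opp.
by rewrite trmxC_realZ !trmxC_mul trmxCK hX mulmxA.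
Qed.

Lemma jump_rate_herm : jump_rate^t* = jump_rate.
Proof.
apply: mx_lift_herm => [f|w]; first exact: Rintegral_opp.
by rewrite trmxC_realZ trmxC_mul trmxCK.
Qed.

(** Cyclicity of the trace under two convergent integrals; this balance of gain and loss yields
    trace preservation. *)
Lemma jump_map_trace X : \tr (jump_map X) = \tr (jump_rate *m X).
Proof.
have ltr : scalar (fun Y : 'M[C]_m => \tr Y) by move=> a Y W; rewrite linearP.
have ltrX : scalar (fun Y : 'M[C]_m => \tr (Y *m X)).
  by move=> a Y W; rewrite mulmxDl -scalemxAl linearP.
have [[_ h1] [_ h2]] := mxrel_scalar lI ltr (jump_map_rel X).
have [[_ h3] [_ h4]] := mxrel_scalar lI ltrX jump_rate_rel.
apply/eqP; rewrite eq_complex -h1 -h2 -h3 -h4.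
have E w : \tr ((gamma w)%:C *: ((Ah w)^t* *m Ah w) *m X) =
    \tr ((gamma w)%:C *: (Ah w *m X *m (Ah w)^t*)).
  move: (Ah w) => F.
  by rewrite -scalemxAl !linearZ /= [in RHS]mxtrace_mulC mulmxA.
by apply/andP; split; apply/eqP; apply: eq_Rintegral => w _; rewrite E.
Qed.

Lemma coherent_term_herm :
  (coherent_term beta kappa H A)^t* = coherent_term beta kappa H A.
Proof.
apply: mx_lift_herm => [f|w]; first exact: Rintegral_opp.
rewrite trmxC_realZ; congr (_ *: _).
apply: mx_lift_herm => [f|t]; first exact: pv_integral_opp.
by rewrite trmxC_realZ trmxC_mul trmxCK.
Qed.

(** This is [-i] times the effective non-Hermitian Hamiltonian [C - (i/2) S], with [C] the coherent
    term and [S] the rate operator. *)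
Definition jump_drift : 'M[C]_m :=
  - 'i *: coherent_term beta kappa H A - (2^-1 : R)%:C *: jump_rate.

Lemma trmxC_iZ (Y : 'M[C]_m) : (- 'i *: Y)^t* = 'i *: Y^t*.
Proof.
rewrite trmxCZ; congr (_ *: _).
by apply/eqP; rewrite eq_complex /= oppr0 opprK !eqxx.
Qed.

Lemma jump_lindbladianE X : jump_lindbladian beta kappa H A X =
  jump_map X + jump_drift *m X + X *m jump_drift^t*.
Proof.
have half : (2^-1 : C) = (2^-1 : R)%:C by rewrite fmorphV rmorph_nat.
rewrite /jump_lindbladian.
(* The dissipator splits into gain and loss because [jump_map_rel] and [jump_rate_rel] give the
   convergence of each. *)
have -> : mx_integral setT (fun w => (gamma w)%:C *: (Ah w *m X *m (Ah w)^t*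
      - 2^-1 *: anticommutator ((Ah w)^t* *m Ah w) X)) =
    jump_map X - (2^-1 : R)%:C *: (jump_rate *m X + X *m jump_rate).
  apply: integral_rel.
  have ll : linear (fun Y => - ((2^-1 : R)%:C *: (Y *m X + X *m Y))).
    move=> a Y Z; rewrite mulmxDl mulmxDr -scalemxAl -scalemxAr.
    rewrite addrACA -(scalerDr a) (scalerDr (2^-1 : R)%:C) opprD scalerN; congr (- _ - _).
    by rewrite !scalerA mulrC.
  have := mxrelD lI (jump_map_rel X) (mxrel_linear lI ll jump_rate_rel).
  congr (mxrel _ _ _); apply/funext => w; move: (Ah w) => F; rewrite half scalerBr; congr (_ - _).
  rewrite /anticommutator -scalemxAl -scalemxAr -scalerDr !scalerA.
  by rewrite mulrC.
rewrite /jump_drift trmxCD trmxC_iZ coherent_term_herm trmxCN trmxC_realZ jump_rate_herm.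
move: (coherent_term _ _ _ _) jump_rate (jump_map X) (2^-1 : R)%:C => K S J h.
rewrite /commutator mulmxBl mulmxBr -!scalemxAl -!scalemxAr.
move: (K *m X) (X *m K) (S *m X) (X *m S) => a b c d.
by apply/matrixP => k l; rewrite !mxE; ring.
Qed.

Lemma jump_lindbladian_linear : linear (jump_lindbladian beta kappa H A).
Proof.
move=> a X Y; rewrite !jump_lindbladianE jump_map_linear.
move: (jump_map X) (jump_map Y) jump_drift => J K D.
rewrite !mulmxDr !mulmxDl -!scalemxAr -!scalemxAl.
move: (D *m X) (D *m Y) (X *m _) (Y *m _) => b c d e.
by apply/matrixP => k l; rewrite !mxE; ring.
Qed.

Lemma jump_lindbladian_herm X : X^t* = X ->
  (jump_lindbladian beta kappa H A X)^t* = jump_lindbladian beta kappa H A X.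
Proof.
move=> hX; rewrite jump_lindbladianE.
move: (jump_map_herm hX); move: (jump_map X) jump_drift => J D hJ.
rewrite !trmxCD hJ !trmxC_mul trmxCK hX.
by rewrite -!addrA; congr (_ + _); rewrite addrC.
Qed.

(** By cyclicity the trace is that of [(S + D + D') X] with [S] the rate and [D] the drift, and
    [D + D' = -S] because the coherent part of [D] is anti-Hermitian. *)
Lemma jump_lindbladian_trace X : \tr (jump_lindbladian beta kappa H A X) = 0.
Proof.
rewrite jump_lindbladianE !linearD /= jump_map_trace mxtrace_mulC [\tr (X *m _)]mxtrace_mulC.
rewrite [in X in X + _ + _]mxtrace_mulC -!linearD -!mulmxDl.
rewrite /jump_drift trmxCD trmxC_iZ coherent_term_herm trmxCN trmxC_realZ jump_rate_herm.
set Y := (_ + _ + _); suff -> : Y = 0 by rewrite mul0mx linear0.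
have hh : (2^-1 : R)%:C + (2^-1 : R)%:C = 1 :> C.
  by rewrite -rmorphD /= (_ : 2^-1 + 2^-1 = 1 :> R)//; field.
rewrite /Y; move: (coherent_term _ _ _ _) jump_rate (2^-1 : R)%:C hh => K S h hh.
apply/matrixP => k l; rewrite !mxE.
transitivity ((1 - (h + h)) * S k l); first by ring.
by rewrite hh subrr mul0r.
Qed.

End Jump.
End ThermalGenerator.

(** * Assembly of the thermal Lindbladian *)

Section ThermalLindbladian.
Variables (R : realType) (beta kappa : R).
Local Notation C := R[i].
Hypotheses (beta0 : 0 < beta) (kappa0 : 0 < kappa).
Variables (n : nat) (H : 'M[C]_(2 ^ n)).
Hypothesis hH : H^t* = H.
Local Notation L := (thermal_lindbladian beta kappa H).
Local Notation P := (@qubit_pauli R n).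

Definition thermal_map (X : 'M[C]_(2 ^ n)) : 'M[C]_(2 ^ n) :=
  \sum_(j < n) \sum_(p < 3) jump_map beta kappa H (P j p) X.

Definition thermal_drift : 'M[C]_(2 ^ n) :=
  - 'i *: H + \sum_(j < n) \sum_(p < 3) jump_drift beta kappa H (P j p).

(** Generators of the form [Phi X + G X + X G'] are closed under sums, and the commutator with [H]
    contributes [-i H] to [G]. *)
Lemma thermal_lindbladianE X :
  L X = thermal_map X + thermal_drift *m X + X *m thermal_drift^t*.
Proof.
rewrite /thermal_lindbladian /thermal_map /thermal_drift.
have -> : \sum_(j < n) \sum_(p < 3) jump_lindbladian beta kappa H (P j p) X =
    \sum_(j < n) \sum_(p < 3) jump_map beta kappa H (P j p) X +
    (\sum_(j < n) \sum_(p < 3) jump_drift beta kappa H (P j p)) *m X +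
    X *m (\sum_(j < n) \sum_(p < 3) jump_drift beta kappa H (P j p))^t*.
  rewrite trmxC_sum mulmx_suml mulmx_sumr -!big_split; apply: eq_bigr => j _ /=.
  rewrite trmxC_sum mulmx_suml mulmx_sumr -!big_split; apply: eq_bigr => p _ /=.
  exact: jump_lindbladianE.
move: (\sum_(j < n) _) (\sum_(j < n) _) => J D.
rewrite trmxCD trmxC_iZ hH mulmxDl mulmxDr -scalemxAl -scalemxAr /commutator.
move: (H *m X) (X *m H) (D *m X) (X *m _) => a b c d.
by apply/matrixP => k l; rewrite !mxE; ring.
Qed.

Lemma thermal_lindbladian_linear : linear L.
Proof.
move=> a X Y; rewrite /thermal_lindbladian (scalerDr a) addrACA; congr (_ + _).
  rewrite /commutator !mulmxDr !mulmxDl -!scalemxAr -!scalemxAl.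
  move: (H *m X) (X *m H) (H *m Y) (Y *m H) => b c d e.
  by apply/matrixP => k l; rewrite !mxE; ring.
rewrite scaler_sumr -big_split; apply: eq_bigr => j _ /=.
rewrite scaler_sumr -big_split; apply: eq_bigr => p _ /=.
exact: jump_lindbladian_linear.
Qed.

Lemma thermal_map_psd X : psdmx X -> psdmx (thermal_map X).
Proof. by move=> pX; do 2!(apply: psdmx_sum => ?); exact: jump_map_psd. Qed.

Lemma thermal_lindbladian_herm X : X^t* = X -> (L X)^t* = L X.
Proof.
move=> hX; rewrite /thermal_lindbladian trmxCD; congr (_ + _).
  rewrite trmxC_iZ /commutator trmxCD trmxCN !trmxC_mul hH hX.
  by rewrite scaleNr -scalerN opprB.
rewrite trmxC_sum; apply: eq_bigr => j _; rewrite trmxC_sum; apply: eq_bigr => p _.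
exact: jump_lindbladian_herm.
Qed.

Lemma thermal_lindbladian_trace X : \tr (L X) = 0.
Proof.
rewrite /thermal_lindbladian linearD linearZ /= /commutator linearB /= mxtrace_mulC subrr mulr0 add0r.
rewrite linear_sum big1// => j _; rewrite linear_sum big1// => p _.
exact: jump_lindbladian_trace.
Qed.

End ThermalLindbladian.

Theorem mainTheorem3 (R : realType) (n : nat) (H : 'M[R[i]]_(2 ^ n))
    (beta kappa t : R) (sigma0 : 'M[R[i]]_(2 ^ n)) :
  H \is hermsymmx ->
  0 < beta ->
  0 < kappa -> kappa <= beta^-1 ->
  0 < t ->
  is_state sigma0 ->
  metastable beta kappa H (2 / t) (time_average beta kappa H t sigma0).
Proof.
move=> /hermP hH beta0 kappa0 _ t0 hsigma.
have lL := thermal_lindbladian_linear beta0 kappa0 hH.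
have pL := thermal_map_psd beta0 kappa0 hH.
have LE := thermal_lindbladianE beta0 kappa0 hH.
have hL := thermal_lindbladian_herm beta0 kappa0 hH.
have tL := thermal_lindbladian_trace beta0 kappa0 hH.
split; first exact: (average_state lL pL LE hL tL).
exact: (average_trace_norm lL pL LE hL tL).
Qed.
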